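(* For every bounded metric space $Z$, $\operatorname{asdim}\operatorname{Co}(Z)\le\operatorname{cdim}Z+1$.
   Context: Hyperbolic cone: if $\operatorname{diam}Z>0$, put $\mu=\pi/\operatorname{diam}Z$; $\operatorname{Co}(Z)$ is $Z\times[0,\infty)/(Z\times\{0\})$ with the metric: for $x=(z,t)$, $x'=(z',t')$, $|xx'|$ is the length of the side $\bar x\bar x'$ of a triangle $\bar o\bar x\bar x'$ in the hyperbolic plane $\mathrm H^2$ with $|\bar o\bar x|=t$, $|\bar o\bar x'|=t'$ and angle $\mu|zz'|$ at $\bar o$. If $Z$ is a point, $\operatorname{Co}(Z)=[0,\infty)$. Asymptotic dimension: $\operatorname{asdim}X$ is the minimal $n$ such that for every $\lambda>0$ there is a $\lambda$-Lipschitz map $f:X\to P$ to a uniform simplicial polyhedron $P$ of dimension $\le n$ with $\sup_\sigma\operatorname{diam}f^{-1}(\sigma)<\infty$ over simplices $\sigma$ of $P$; a uniform polyhedron is a simplicial polyhedron isometric to a subcomplex of $\Delta^J=\{x\in\mathbb R^J:x_j\ge0,\sum x_j=1\}$, $\mathbb R^J$ the finitely supported functions $J\to\mathbb R$ with $\ell^2$ distance. Capacity dimension: for an open covering $\mathcal U$ of $Z$ let $\operatorname{mesh}(\mathcal U,z)=\sup\{\operatorname{diam}U:z\in U\in\mathcal U\}$, $\operatorname{mesh}(\mathcal U)=\sup_U\operatorname{diam}U$, $L(\mathcal U,z)=\min\{\sup_{U\in\mathcal U}\operatorname{dist}(z,Z\setminus U),\operatorname{mesh}(\mathcal U,z)\}$,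 $L(\mathcal U)=\inf_zL(\mathcal U,z)$, $\operatorname{cap}(\mathcal U)=L(\mathcal U)/\operatorname{mesh}(\mathcal U)$ (set to $1$ if $\operatorname{mesh}=0$ or $L=\operatorname{mesh}=\infty$). A covering is $(m+1)$-colored if it is a union of $m+1$ subfamilies each of pairwise disjoint sets. For $\tau>0$, $\delta\in(0,1)$, integer $m\ge0$, $c_\tau(Z,m,\delta)$ is the supremum (0 if empty) of $\operatorname{cap}(\mathcal U)$ over open $(m+1)$-colored coverings with $\delta\tau\le\operatorname{mesh}(\mathcal U)\le\tau$; $c(Z,m,\delta)=\liminf_{\tau\to0}c_\tau(Z,m,\delta)$; $c(Z,m)=\lim_{\delta\to0}c(Z,m,\delta)$; $\operatorname{cdim}Z=\inf\{m:c(Z,m)>0\}$. *)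

(* Defs.v *)
From Stdlib Require Import Reals List.
From Coquelicot Require Import Coquelicot.
Open Scope R_scope.

Definition is_metric {X : Type} (d : X -> X -> R) : Prop :=
  (forall x y, 0 <= d x y) /\ (forall x y, d x y = 0 <-> x = y) /\
  (forall x y, d x y = d y x) /\ (forall x y z, d x z <= d x y + d y z).

Definition bounded_metric {X : Type} (d : X -> X -> R) : Prop :=
  exists B : R, forall x y, d x y <= B.

(** diam Z (finite, since Z is bounded) *)
Definition diamZ {Z : Type} (d : Z -> Z -> R) : R :=
  real (Lub_Rbar (fun r => exists x y : Z, r = d x y)).

(** * Hyperbolic cone Co(Z) = Z x [0,oo) / (Z x {0}).
    Realised as the quotient itself: [None] is the vertex (class of Z x {0}),
    [Some (z,t)] is the point (z,t) with t > 0. *)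
Definition Cone (Z : Type) : Type := option (Z * {t : R | 0 < t}).

Definition cone_t {Z : Type} (x : Cone Z) : R :=
  match x with None => 0 | Some (_, t) => proj1_sig t end.

(** angle at the vertex: mu |zz'| with mu = pi / diam Z (if diam Z > 0);
    if Z is a point the angle is 0, so that Co(Z) = [0,oo) with |t - t'|.
    When one of the points is the vertex, t = 0 and the angle is irrelevant. *)
Definition cone_angle {Z : Type} (d : Z -> Z -> R) (x x' : Cone Z) : R :=
  match x, x' with
  | Some (z, _), Some (z', _) =>
      if Rlt_dec 0 (diamZ d) then PI / diamZ d * d z z' else 0
  | _, _ => 0
  end.

Definition arcosh (y : R) : R := ln (y + sqrt (y * y - 1)).

(** hyperbolic law of cosines in H^2:
    cosh c = cosh t cosh t' - sinh t sinh t' cos(angle) *)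
Definition cone_dist {Z : Type} (d : Z -> Z -> R) (x x' : Cone Z) : R :=
  arcosh (cosh (cone_t x) * cosh (cone_t x')
          - sinh (cone_t x) * sinh (cone_t x') * cos (cone_angle d x x')).

(** A simplicial subcomplex of Delta^J: a family K of simplices, each given by
    its (duplicate-free, nonempty) list of vertices, closed under faces. *)
Definition subcomplex {J : Type} (K : list J -> Prop) : Prop :=
  (forall S, K S -> NoDup S /\ S <> nil) /\
  (forall S S', K S -> NoDup S' -> S' <> nil -> incl S' S -> K S').

Definition dim_le {J : Type} (K : list J -> Prop) (n : nat) : Prop :=
  forall S, K S -> (length S <= n + 1)%nat.

Definition sum_over {J : Type} (S : list J) (g : J -> R) : R :=
  fold_right (fun j acc => g j + acc) 0 S.

Definition in_simplex {J : Type} (S : list J) (x : J -> R) : Prop :=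
  (forall j, 0 <= x j) /\ (forall j, x j <> 0 -> In j S) /\ sum_over S x = 1.

Definition in_polyhedron {J : Type} (K : list J -> Prop) (x : J -> R) : Prop :=
  exists S, K S /\ in_simplex S x.

(** l^2 distance of finitely supported functions, computed on any
    duplicate-free list containing both supports *)
Definition l2_le {J : Type} (x y : J -> R) (c : R) : Prop :=
  forall L : list J, NoDup L -> (forall j, x j <> 0 \/ y j <> 0 -> In j L) ->
    sqrt (sum_over L (fun j => (x j - y j) ^ 2)) <= c.

Definition asdim_le {X : Type} (d : X -> X -> R) (n : nat) : Prop :=
  forall lam : R, 0 < lam ->
  exists (J : Type) (K : list J -> Prop) (f : X -> J -> R),
    subcomplex K /\ dim_le K n /\
    (forall a, in_polyhedron K (f a)) /\
    (forall a b, l2_le (f a) (f b) (lam * d a b)) /\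
    (exists D : R, forall S, K S -> forall a b,
        in_simplex S (f a) -> in_simplex S (f b) -> d a b <= D).

Section Cap.
Context {Z : Type} (d : Z -> Z -> R).

Definition open_set (U : Z -> Prop) : Prop :=
  forall x, U x -> exists e, 0 < e /\ forall y, d x y < e -> U y.

Definition open_cover (cov : (Z -> Prop) -> Prop) : Prop :=
  (forall U, cov U -> open_set U) /\ (forall z, exists U, cov U /\ U z).

(** union of m+1 subfamilies, each consisting of pairwise disjoint sets *)
Definition colored (m : nat) (cov : (Z -> Prop) -> Prop) : Prop :=
  exists col : (Z -> Prop) -> nat,
    (forall U, cov U -> (col U <= m)%nat) /\
    (forall U V, cov U -> cov V -> col U = col V ->
       (exists x, U x /\ V x) -> forall y, U y <-> V y).

Definition diam_set (U : Z -> Prop) : Rbar :=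
  Rbar_lub (fun r => (r = Finite 0 /\ ~ exists x, U x) \/
                     exists x y, U x /\ U y /\ r = Finite (d x y)).

Definition mesh (cov : (Z -> Prop) -> Prop) : Rbar :=
  Rbar_lub (fun r => exists U, cov U /\ r = diam_set U).

Definition mesh_at (cov : (Z -> Prop) -> Prop) (z : Z) : Rbar :=
  Rbar_lub (fun r => exists U, cov U /\ U z /\ r = diam_set U).

(** dist(z, A), = +oo for A empty *)
Definition dist_to (z : Z) (A : Z -> Prop) : Rbar :=
  Glb_Rbar (fun r => exists a, A a /\ r = d z a).

Definition L_at (cov : (Z -> Prop) -> Prop) (z : Z) : Rbar :=
  Rbar_min (Rbar_lub (fun r => exists U, cov U /\ r = dist_to z (fun y => ~ U y)))
           (mesh_at cov z).

Definition L_cov (cov : (Z -> Prop) -> Prop) : Rbar :=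
  Rbar_glb (fun r => exists z, r = L_at cov z).

Definition cap (cov : (Z -> Prop) -> Prop) : Rbar :=
  match mesh cov with
  | Finite mr => if Req_EM_T mr 0 then Finite 1
                 else Rbar_mult (L_cov cov) (Finite (/ mr))
  | p_infty => match L_cov cov with p_infty => Finite 1 | _ => Finite 0 end
  | m_infty => Finite 1
  end.

Definition good_cover (m : nat) (delta tau : R) (cov : (Z -> Prop) -> Prop) : Prop :=
  open_cover cov /\ colored m cov /\
  Rbar_le (Finite (delta * tau)) (mesh cov) /\ Rbar_le (mesh cov) (Finite tau).

Definition c_tau (m : nat) (delta tau : R) : Rbar :=
  Rbar_lub (fun r => (r = Finite 0 /\ ~ exists cov, good_cover m delta tau cov) \/
                     exists cov, good_cover m delta tau cov /\ r = cap cov).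

Definition c_delta (m : nat) (delta : R) : Rbar :=
  Rbar_lub (fun r => exists eps, 0 < eps /\
     r = Rbar_glb (fun s => exists tau, 0 < tau < eps /\ s = c_tau m delta tau)).

Definition c_lim_is (m : nat) (l : R) : Prop :=
  forall eps, 0 < eps -> exists eta, 0 < eta /\ forall delta, 0 < delta -> delta < eta ->
    delta < 1 ->
    Rbar_le (Finite (l - eps)) (c_delta m delta) /\
    Rbar_le (c_delta m delta) (Finite (l + eps)).

(** cdim Z <= m, where cdim Z = inf {m' | c(Z,m') > 0} *)
Definition cdim_le (m : nat) : Prop :=
  exists m', (m' <= m)%nat /\ exists l, c_lim_is m' l /\ 0 < l.

End Cap.

(* Main.v *)
Require Import Defs.
From Stdlib Require Import ZArith Reals List Lra Lia Classical ClassicalEpsilon.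
From Stdlib Require Import FunctionalExtensionality PropExtensionality.
From Coquelicot Require Import Coquelicot.
Open Scope R_scope.

(** A positive capacity gives, at every scale [tau], an [m+1]-coloured covering
    of [Z] of mesh [<= tau] and Lebesgue number [>= c tau].  Take the scales
    [tau_k = A exp (- k T)] with [T] and then [A] large.  Near [Z x {k T}] the
    cone is mapped to the nerve of the k-th covering by a partition of unity;
    since the partition is Lipschitz with constant of order [1 / tau_k] and
    horizontal distances on the sphere of radius [k T] are of order
    [exp (k T)] times those of [Z], this map has constant of order
    [exp T / A].  For [t] between [k T] and [(k+1) T] one runs through the
    mapping cylinder of a simplicial map from the (k+1)-st nerve to the k-th
    one, sending a set to a set containing it.  Ordering vertices by colour
    triangulates each prism of the cylinder without new vertices, so that the
    dimension increases only by one, and the radial Lipschitz constant is of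
    order [1 / T]. *)

(** * Finite sums and finitely supported masses *)

Section Sums.
Context {A : Type}.
Implicit Types (l : list A) (f g : A -> R).

Lemma sum_over_ext l f g :
  (forall a, In a l -> f a = g a) -> sum_over l f = sum_over l g.
Proof.
  induction l as [|a l IH]; simpl; intros H; [reflexivity|].
  rewrite H, IH; auto.
Qed.

Lemma sum_over_le l f g :
  (forall a, In a l -> f a <= g a) -> sum_over l f <= sum_over l g.
Proof.
  induction l as [|a l IH]; simpl; intros H; [lra|].
  apply Rplus_le_compat; auto.
Qed.

Lemma sum_over_const l c : sum_over l (fun _ => c) = INR (length l) * c.
Proof.
  induction l as [|a l IH]; simpl sum_over; [simpl; ring|].
  rewrite IH. change (length (a :: l)) with (S (length l)). rewrite S_INR. ring.
Qed.

Lemma sum_over_plus l f g :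
  sum_over l (fun a => f a + g a) = sum_over l f + sum_over l g.
Proof. induction l as [|a l IH]; simpl; [ring|]. rewrite IH. ring. Qed.

Lemma sum_over_minus l f g :
  sum_over l (fun a => f a - g a) = sum_over l f - sum_over l g.
Proof. induction l as [|a l IH]; simpl; [ring|]. rewrite IH. ring. Qed.

Lemma sum_over_scal l f c : sum_over l (fun a => c * f a) = c * sum_over l f.
Proof. induction l as [|a l IH]; simpl; [ring|]. rewrite IH. ring. Qed.

Lemma sum_over_nonneg l f : (forall a, In a l -> 0 <= f a) -> 0 <= sum_over l f.
Proof.
  intros H. replace 0 with (sum_over l (fun _ => 0)).
  - now apply sum_over_le.
  - rewrite sum_over_const. ring.
Qed.

Lemma sum_over_ge_term l f a :
  (forall b, In b l -> 0 <= f b) -> In a l -> f a <= sum_over l f.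
Proof.
  induction l as [|b l IH]; simpl; intros H Ha; [tauto|].
  destruct Ha as [->|Ha].
  - assert (0 <= sum_over l f) by (apply sum_over_nonneg; auto). lra.
  - assert (f a <= sum_over l f) by auto. assert (0 <= f b) by auto. lra.
Qed.

Lemma sum_over_abs l f : Rabs (sum_over l f) <= sum_over l (fun a => Rabs (f a)).
Proof.
  induction l as [|a l IH]; simpl; [rewrite Rabs_R0; lra|].
  eapply Rle_trans; [apply Rabs_triang|]. lra.
Qed.

Lemma sum_over_l1_triangle l f g h :
  sum_over l (fun a => Rabs (f a - h a)) <=
  sum_over l (fun a => Rabs (f a - g a)) + sum_over l (fun a => Rabs (g a - h a)).
Proof.
  rewrite <- sum_over_plus. apply sum_over_le. intros a _.
  replace (f a - h a) with ((f a - g a) + (g a - h a)) by ring. apply Rabs_triang.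
Qed.

Lemma sum_over_app l l' f : sum_over (l ++ l') f = sum_over l f + sum_over l' f.
Proof. induction l as [|a l IH]; simpl; [ring|]. rewrite IH. ring. Qed.

Lemma sum_over_map {B : Type} (h : B -> A) (l : list B) f :
  sum_over (map h l) f = sum_over l (fun b => f (h b)).
Proof. induction l as [|b l IH]; simpl; [reflexivity|]. now rewrite IH. Qed.

Lemma sum_over_single l a c :
  NoDup l ->
  sum_over l (fun b => if excluded_middle_informative (a = b) then c else 0) =
  if in_dec (fun x y => excluded_middle_informative (x = y)) a l then c else 0.
Proof.
  intros Hl. induction Hl as [|b l Hb Hl IH]; [reflexivity|].
  change (sum_over (b :: l) ?f) with (f b + sum_over l f). rewrite IH.
  destruct (in_dec _ a l) as [Ha|Ha]; destruct (in_dec _ a (b :: l)) as [Hab|Hab];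
    destruct (excluded_middle_informative (a = b)) as [Hd|Hd];
    try subst b; simpl in *; try tauto; try ring.
  destruct Hab as [->|Hab]; tauto.
Qed.

(** The square of a sum of nonnegative numbers dominates the sum of their squares. All Lipschitz
    estimates below are made in the [l^1] norm, and this lemma turns them into the [l^2] bound of
    [l2_le]. *)
Lemma sum_over_sq_le l f :
  sqrt (sum_over l (fun a => f a ^ 2)) <= sum_over l (fun a => Rabs (f a)).
Proof.
  assert (Hp : forall k, 0 <= sum_over k (fun a => Rabs (f a)))
    by (intros k; apply sum_over_nonneg; intros; apply Rabs_pos).
  rewrite <- (sqrt_Rsqr (sum_over l (fun a => Rabs (f a)))) by apply Hp.
  apply sqrt_le_1_alt. unfold Rsqr.
  induction l as [|a l IH]; [simpl; lra|].
  change (sum_over (a :: l) ?g) with (g a + sum_over l g); cbv beta.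
  assert (H := Hp l). assert (H2 := Rabs_pos (f a)).
  assert (f a ^ 2 = Rabs (f a) * Rabs (f a)).
  { rewrite <- Rabs_mult, Rabs_pos_eq; [ring|]. nra. }
  assert (0 <= Rabs (f a) * sum_over l (fun a => Rabs (f a)))
    by now apply Rmult_le_pos.
  lra.
Qed.
End Sums.

Lemma sum_over_swap {A B : Type} (l : list A) (l' : list B) (f : A -> B -> R) :
  sum_over l (fun a => sum_over l' (f a)) =
  sum_over l' (fun b => sum_over l (fun a => f a b)).
Proof.
  induction l as [|a l IH]; simpl; [rewrite sum_over_const; ring|].
  now rewrite IH, sum_over_plus.
Qed.

Lemma sum_over_prod {A B : Type} (l : list A) (l' : list B) (f : A * B -> R) :
  sum_over (list_prod l l') f =
  sum_over l (fun a => sum_over l' (fun b => f (a, b))).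
Proof.
  induction l as [|a l IH]; simpl; [reflexivity|].
  now rewrite sum_over_app, sum_over_map, IH.
Qed.

Section Mass.
Context {A J : Type}.
Implicit Types (I : list A) (w : A -> R) (v : A -> J).

(** The push-forward of the weights [w] under [v]: indices with the same image have their weights
    added. *)
Definition mass I w v (j : J) : R :=
  sum_over I (fun i => if excluded_middle_informative (v i = j) then w i else 0).

Lemma mass_nonneg I w v j : (forall i, In i I -> 0 <= w i) -> 0 <= mass I w v j.
Proof.
  intros H. apply sum_over_nonneg. intros i Hi.
  destruct (excluded_middle_informative _); [auto|lra].
Qed.

Lemma mass_support I w v j :
  mass I w v j <> 0 -> exists i, In i I /\ v i = j /\ w i <> 0.
Proof.
  intros H. apply NNPP. intros H0. apply H. unfold mass.
  rewrite (sum_over_ext _ _ (fun _ => 0)); [rewrite sum_over_const; ring|].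
  intros i Hi. destruct (excluded_middle_informative _) as [e|e]; [|reflexivity].
  apply NNPP. intros Hw. apply H0. exists i. auto.
Qed.

Lemma mass_support_in I w v i :
  (forall i, In i I -> 0 <= w i) -> In i I -> w i <> 0 -> mass I w v (v i) <> 0.
Proof.
  intros H Hi Hw.
  assert (w i <= mass I w v (v i)); [|specialize (H i Hi); lra].
  replace (w i) with
    (if excluded_middle_informative (v i = v i) then w i else 0)
    by (destruct (excluded_middle_informative _); congruence).
  unfold mass.
  apply (sum_over_ge_term I
    (fun i0 => if excluded_middle_informative (v i0 = v i) then w i0 else 0)); auto.
  intros b Hb. destruct (excluded_middle_informative _); [auto|lra].
Qed.

Lemma mass_total I w v L :
  NoDup L -> (forall i, In i I -> w i <> 0 -> In (v i) L) ->
  sum_over L (mass I w v) = sum_over I w.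
Proof.
  intros HL H. unfold mass. rewrite sum_over_swap. apply sum_over_ext.
  intros i Hi. rewrite sum_over_single by auto.
  destruct (in_dec _ _ _) as [h|h]; [reflexivity|].
  apply NNPP. intros Hw. apply h, H; auto.
Qed.

Lemma mass_total_le I w v L :
  NoDup L -> (forall i, In i I -> 0 <= w i) ->
  sum_over L (mass I w v) <= sum_over I w.
Proof.
  intros HL H. unfold mass. rewrite sum_over_swap. apply sum_over_le.
  intros i Hi. rewrite sum_over_single by auto.
  destruct (in_dec _ _ _) as [h|h]; [lra|auto].
Qed.

(** Each index contributes at most [eps]: if its target is unchanged, only the difference of its
    weights counts; if the target may jump, both weights count in full, but they are small. *)
Lemma mass_l1_le I w v w' v' eps L :
  (forall i, In i I ->
     v i = v' i /\ Rabs (w i - w' i) <= eps \/ Rabs (w i) + Rabs (w' i) <= eps) ->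
  NoDup L ->
  sum_over L (fun j => Rabs (mass I w v j - mass I w' v' j)) <= INR (length I) * eps.
Proof.
  intros H HL. rewrite <- sum_over_const.
  eapply Rle_trans.
  { apply sum_over_le. intros j _. unfold mass. rewrite <- sum_over_minus.
    apply sum_over_abs. }
  rewrite sum_over_swap. apply sum_over_le. intros i Hi.
  destruct (H i Hi) as [[Hv Hw]|Hw].
  - rewrite <- Hv.
    rewrite (sum_over_ext _ _ (fun j => if excluded_middle_informative (v i = j)
       then Rabs (w i - w' i) else 0)).
    + rewrite sum_over_single by auto.
      assert (K := Rabs_pos (w i - w' i)). destruct (in_dec _ _ _); lra.
    + intros j _. destruct (excluded_middle_informative _); [reflexivity|].
      rewrite Rminus_0_r, Rabs_R0. reflexivity.
  - eapply Rle_trans.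
    { apply (sum_over_le _ _ (fun j =>
       (if excluded_middle_informative (v i = j) then Rabs (w i) else 0)
       + (if excluded_middle_informative (v' i = j) then Rabs (w' i) else 0))).
      intros j _. eapply Rle_trans; [apply Rabs_triang|]. rewrite Rabs_Ropp.
      repeat destruct (excluded_middle_informative _); rewrite ?Rabs_R0; lra. }
    rewrite sum_over_plus.
    rewrite !sum_over_single by auto.
    assert (K := Rabs_pos (w i)). assert (K' := Rabs_pos (w' i)).
    repeat destruct (in_dec _ _ _); lra.
Qed.
End Mass.

(** * Coloured coverings and their partitions of unity *)

Section Partition.
Context {Z : Type} (d : Z -> Z -> R) (Hd : is_metric d).
Implicit Types (E : nat -> Z -> Z -> Prop) (n i : nat) (sigma tau : R) (z a : Z).

(** [E i] is the relation "some member of colour [i] contains both points". *)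
Definition colour_cover E n sigma tau : Prop :=
  (forall i z a, E i z a -> E i a z) /\
  (forall i z a b, E i z a -> E i a b -> E i z b) /\
  (forall i z a, E i z a -> d z a <= tau) /\
  (forall z, exists i, (i < n)%nat /\ forall a, d z a < sigma -> E i z a).

(* The distance from z to the complement of its class, capped at sigma;
   it is 0 when z has no class, since then a = z is allowed. *)
Definition depth E sigma i z : R :=
  real (Glb_Rbar (fun r => r = sigma \/ exists a, ~ E i z a /\ r = d z a)).

Definition total_depth E n sigma z : R :=
  sum_over (seq 0 n) (fun i => depth E sigma i z).

Definition weight E n sigma i z : R := depth E sigma i z / total_depth E n sigma z.

(** The infimum is a real number, because [sigma] belongs to the set and 0 is a lower bound. *)
Lemma depth_spec E sigma i z : 0 < sigma ->
  (0 <= depth E sigma i z) /\ (depth E sigma i z <= sigma) /\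
  (forall a, ~ E i z a -> depth E sigma i z <= d z a) /\
  (forall r, r <= sigma -> (forall a, ~ E i z a -> r <= d z a) ->
     r <= depth E sigma i z).
Proof.
  intros Hs. unfold depth.
  assert (H := Glb_Rbar_correct
    (fun r => r = sigma \/ exists a, ~ E i z a /\ r = d z a)).
  set (g := Glb_Rbar _) in *. destruct H as [Hlb Hglb].
  assert (H0 : Rbar_le 0 g).
  { apply Hglb. intros r [->|[a [_ ->]]]; simpl; [lra|apply Hd]. }
  assert (H1 : Rbar_le g sigma) by (apply Hlb; auto).
  destruct g as [g| |]; simpl in *; try tauto.
  repeat split; auto.
  - intros a Ha. apply (Hlb (d z a)). right. exists a. auto.
  - intros r Hr Hra. apply (Hglb r). intros x [->|[a [Ha ->]]]; simpl; auto.
Qed.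

Section Scale.
Context (E : nat -> Z -> Z -> Prop) (n : nat) (sigma tau : R).
Context (HE : colour_cover E n sigma tau) (Hs : 0 < sigma).

Lemma class_eq i z a : E i z a -> E i z = E i a.
Proof.
  destruct HE as (Hsym & Htr & _). intros H.
  apply functional_extensionality; intros b. apply propositional_extensionality.
  split; eauto.
Qed.

(** Points of one class have the same complement to measure; otherwise each point lies outside the
    class of the other, and both depths are at most [d z a]. *)
Lemma depth_lipschitz i z a :
  Rabs (depth E sigma i z - depth E sigma i a) <= d z a.
Proof.
  destruct Hd as (Hpos & _ & Hsy & Htri).
  destruct (depth_spec E sigma i z Hs) as (A1 & A2 & A3 & A4).
  destruct (depth_spec E sigma i a Hs) as (B1 & B2 & B3 & B4).
  destruct (classic (E i z a)) as [H|H].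
  - assert (He := class_eq _ _ _ H).
    assert (P := Hpos z a).
    assert (depth E sigma i z - d z a <= depth E sigma i a).
    { apply B4; [lra|]. intros b Hb. rewrite <- He in Hb.
      specialize (A3 b Hb). specialize (Htri z a b). lra. }
    assert (depth E sigma i a - d z a <= depth E sigma i z).
    { apply A4; [lra|]. intros b Hb. rewrite He in Hb.
      specialize (B3 b Hb). specialize (Htri a z b). rewrite (Hsy a z) in Htri. lra. }
    apply Rabs_le. lra.
  - assert (H' : ~ E i a z) by (intros h; apply H; now apply (proj1 HE)).
    specialize (A3 a H). specialize (B3 z H'). rewrite Hsy in B3.
    apply Rabs_le. lra.
Qed.

Lemma depth_neq_class i z a :
  E i z <> E i a -> depth E sigma i z <= d z a.
Proof.
  intros H. apply (depth_spec E sigma i z Hs). intros h. now apply H, class_eq.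
Qed.

(** The Lebesgue property provides a colour whose class contains the [sigma]-ball at [z]; its depth
    alone is at least [sigma]. This keeps the denominator of [weight] away from 0. *)
Lemma total_depth_ge z : sigma <= total_depth E n sigma z.
Proof.
  destruct HE as (_ & _ & _ & HL). destruct (HL z) as (i & Hi & Ha).
  apply Rle_trans with (depth E sigma i z).
  - apply (depth_spec E sigma i z Hs); [lra|]. intros a Hn.
    apply Rnot_lt_le. auto.
  - apply (sum_over_ge_term (seq 0 n) (fun i => depth E sigma i z)).
    + intros j _. exact (proj1 (depth_spec E sigma j z Hs)).
    + apply in_seq. lia.
Qed.

Lemma weight_nonneg i z : 0 <= weight E n sigma i z.
Proof.
  assert (H := total_depth_ge z). destruct (depth_spec E sigma i z Hs) as [H1 _].
  apply Rmult_le_pos; [auto|]. left. apply Rinv_0_lt_compat. lra.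
Qed.

Lemma weight_sum z : sum_over (seq 0 n) (fun i => weight E n sigma i z) = 1.
Proof.
  assert (H := total_depth_ge z).
  rewrite (sum_over_ext _ _ (fun i => / total_depth E n sigma z * depth E sigma i z)).
  - rewrite sum_over_scal. fold (total_depth E n sigma z). field. lra.
  - intros i _. unfold weight. field. lra.
Qed.

Lemma weight_support i z : weight E n sigma i z <> 0 -> E i z z.
Proof.
  intros H. apply NNPP. intros Hn. apply H.
  destruct (depth_spec E sigma i z Hs) as (A1 & _ & A3 & _).
  specialize (A3 z Hn). assert (d z z = 0) by exact (proj2 (proj1 (proj2 Hd) z z) eq_refl).
  unfold weight. replace (depth E sigma i z) with 0 by lra. field.
  assert (K := total_depth_ge z). lra.
Qed.

Lemma weight_neq_class i z a :
  E i z <> E i a -> weight E n sigma i z <= d z a / sigma.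
Proof.
  intros H. assert (K := total_depth_ge z). assert (K1 := depth_neq_class i z a H).
  assert (P := proj1 Hd z a).
  unfold weight, Rdiv. apply Rmult_le_compat; auto.
  - exact (proj1 (depth_spec E sigma i z Hs)).
  - left. apply Rinv_0_lt_compat. lra.
  - now apply Rinv_le_contravar.
Qed.

Lemma weight_lipschitz i z a :
  (i < n)%nat ->
  Rabs (weight E n sigma i z - weight E n sigma i a) <= (INR n + 1) * (d z a / sigma).
Proof.
  intros Hi.
  assert (Kz := total_depth_ge z). assert (Ka := total_depth_ge a).
  assert (HT : Rabs (total_depth E n sigma z - total_depth E n sigma a) <= INR n * d z a).
  { unfold total_depth. rewrite <- sum_over_minus.
    eapply Rle_trans; [apply sum_over_abs|].
    rewrite <- (length_seq n 0) at 2. rewrite <- sum_over_const.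
    apply sum_over_le. intros j _. apply depth_lipschitz. }
  assert (HD := depth_lipschitz i z a).
  assert (Hw := weight_nonneg i a).
  assert (Hw1 : weight E n sigma i a <= 1).
  { rewrite <- (weight_sum a).
    apply (sum_over_ge_term (seq 0 n) (fun i => weight E n sigma i a)).
    - intros; apply weight_nonneg.
    - apply in_seq; lia. }
  assert (P := proj1 Hd z a).
  set (Tz := total_depth E n sigma z) in *. set (Ta := total_depth E n sigma a) in *.
  (* A quotient rule with the single denominator [Tz]: the numerator costs [d z a] for the depth and
     [INR n * d z a] for the total, whence the factor [INR n + 1]. *)
  replace (weight E n sigma i z - weight E n sigma i a) with
    (((depth E sigma i z - depth E sigma i a) - weight E n sigma i a * (Tz - Ta)) / Tz)
    by (unfold weight; fold Tz Ta; field; lra).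
  unfold Rdiv. rewrite Rabs_mult, (Rabs_pos_eq (/ Tz))
    by (left; apply Rinv_0_lt_compat; lra).
  rewrite <- Rmult_assoc. apply Rmult_le_compat; try apply Rabs_pos.
  - left; apply Rinv_0_lt_compat; lra.
  - eapply Rle_trans; [apply Rabs_triang|]. rewrite Rabs_Ropp, Rabs_mult.
    rewrite (Rabs_pos_eq _ Hw).
    assert (weight E n sigma i a * Rabs (Tz - Ta) <= 1 * (INR n * d z a)).
    { apply Rmult_le_compat; auto. apply Rabs_pos. }
    lra.
  - now apply Rinv_le_contravar.
Qed.

(** When the only class is all of [Z], in colour 0, the depth is [sigma] for that colour and 0 for
    the others. Near the vertex of the cone this makes the map independent of [z]. *)
Lemma weight_trivial i z a :
  (forall j x y, E j x y <-> j = 0%nat) -> weight E n sigma i z = weight E n sigma i a.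
Proof.
  intros H.
  assert (Hdep : forall j, depth E sigma j z = depth E sigma j a).
  { assert (K : forall j x, depth E sigma j x = if Nat.eq_dec j 0 then sigma else 0).
    { intros j x. destruct (depth_spec E sigma j x Hs) as (A1 & A2 & A3 & A4).
      destruct (Nat.eq_dec j 0) as [e|e].
      - apply Rle_antisym; auto. apply A4; [lra|]. intros y Hy. exfalso. now apply Hy, H.
      - apply Rle_antisym; auto. rewrite <- (proj2 (proj1 (proj2 Hd) x x) eq_refl).
        apply A3. now rewrite H. }
    intros j. now rewrite !K. }
  unfold weight, total_depth. rewrite Hdep. f_equal. apply sum_over_ext. auto.
Qed.
End Scale.
End Partition.

(** * From capacity dimension to coloured coverings at every scale *)

Lemma Rbar_lub_ex (S : Rbar -> Prop) (v : Rbar) :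
  Rbar_lt v (Rbar_lub S) -> exists r, S r /\ Rbar_lt v r.
Proof.
  intros H. apply NNPP. intros Hn. apply (Rbar_lt_not_le _ _ H).
  unfold Rbar_lub. destruct (Rbar_ex_lub S) as [l [Hl0 Hl]]. simpl.
  apply Hl. intros r Hr. apply Rbar_not_lt_le. intros h. apply Hn. eauto.
Qed.

Lemma Rbar_lub_ge (S : Rbar -> Prop) (r : Rbar) : S r -> Rbar_le r (Rbar_lub S).
Proof.
  intros H. unfold Rbar_lub. destruct (Rbar_ex_lub S) as [l [Hl Hl0]]. now apply Hl.
Qed.

Lemma Rbar_glb_le (S : Rbar -> Prop) (r : Rbar) : S r -> Rbar_le (Rbar_glb S) r.
Proof.
  intros H. unfold Rbar_glb. destruct (Rbar_ex_glb S) as [l [Hl Hl0]]. now apply Hl.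
Qed.

Section Covers.
Context {Z : Type} (d : Z -> Z -> R) (Hd : is_metric d).

(** A positive mesh requires a member of positive diameter, and the empty set has diameter 0. *)
Lemma good_cover_inhabited m delta tau cov :
  0 < delta * tau -> good_cover d m delta tau cov -> inhabited Z.
Proof.
  intros Hp (_ & _ & Hm & _).
  destruct (Rbar_lub_ex _ 0 (Rbar_lt_le_trans 0 (delta * tau) _ Hp Hm))
    as (r & (U & _ & ->) & HU).
  destruct (Rbar_lub_ex _ 0 HU) as (r & [[-> _]|(x & _)] & Hr).
  - simpl in Hr. lra.
  - exact (inhabits x).
Qed.

(** The capacity bound gives a Lebesgue number above [c] times the mesh, and the mesh is at least
    [delta * tau]. The relation is transitive because members of one colour that meet coincide. *)
Lemma good_cover_colour_cover m delta tau c cov :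
  0 < delta * tau -> 0 < c -> good_cover d m delta tau cov -> Rbar_lt c (cap d cov) ->
  exists E, colour_cover d E (m + 1) (c * delta * tau) tau.
Proof.
  intros Hp Hc (Hop & (col & Hcol1 & Hcol2) & Hm1 & Hm2) Hcap.
  (* The mesh lies between [delta * tau > 0] and [tau], so the default values in [cap] do not occur
     and the quotient can be cleared. *)
  assert (HL : exists mr, Rbar_le (delta * tau) (Finite mr) /\
    Rbar_lt (c * mr) (L_cov d cov)).
  { unfold cap in Hcap. destruct (mesh d cov) as [mr| |]; simpl in Hm1, Hm2; try tauto.
    exists mr. split; [auto|]. destruct (Req_EM_T mr 0) as [e|e]; [lra|].
    destruct (L_cov d cov) as [l| |]; simpl; auto.
    - simpl in Hcap. apply Rmult_lt_reg_r with (/ mr).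
      + apply Rinv_0_lt_compat. lra.
      + rewrite Rmult_assoc, Rinv_r, Rmult_1_r by auto. auto.
    - simpl in Hcap. destruct (Rle_dec 0 (/ mr)) as [h|h].
      + destruct (Rle_lt_or_eq_dec 0 (/ mr) h) as [h'|h']; simpl in Hcap; [tauto|].
        assert (0 < / mr) by (apply Rinv_0_lt_compat; lra). lra.
      + assert (0 < / mr) by (apply Rinv_0_lt_compat; lra). lra. }
  destruct HL as (mr & Hmr & HL). simpl in Hmr.
  exists (fun i z a => exists U, cov U /\ col U = i /\ U z /\ U a).
  split; [|split; [|split]].
  - intros i z a (U & A & B & C & D). exists U. auto.
  - intros i z a b (U & A & B & C & D) (V & A' & B' & C' & D').
    exists U. repeat split; auto.
    apply (Hcol2 U V); auto; [congruence|]. exists a. auto.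
  - intros i z a (U & A & B & C & D).
    assert (K1 : Rbar_le (d z a) (diam_set d U)).
    { apply Rbar_lub_ge. right. exists z, a. auto. }
    assert (K2 : Rbar_le (diam_set d U) (mesh d cov)).
    { apply Rbar_lub_ge. exists U. auto. }
    assert (K := Rbar_le_trans _ _ _ K1 (Rbar_le_trans _ _ _ K2 Hm2)).
    exact K.
  - intros z.
    assert (Hz : Rbar_le (L_cov d cov) (L_at d cov z)).
    { apply Rbar_glb_le. exists z. auto. }
    assert (Hz' := Rbar_lt_le_trans _ _ _ HL Hz). unfold L_at in Hz'.
    assert (Hz2 := Rbar_lt_le_trans _ _ _ Hz' (Rbar_min_l _ _)).
    destruct (Rbar_lub_ex _ _ Hz2) as (r & (U & HU & ->) & Hr).
    assert (HB : forall a, d z a < c * delta * tau -> U a).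
    { intros a Ha. apply NNPP. intros Hn.
      destruct (Glb_Rbar_correct (fun r => exists a, ~ U a /\ r = d z a)) as [Hlb _].
      assert (K := Rbar_lt_le_trans _ _ _ Hr (Hlb (d z a) (ex_intro _ a (conj Hn eq_refl)))).
      simpl in K. assert (c * (delta * tau) <= c * mr) by (apply Rmult_le_compat_l; lra).
      lra. }
    exists (col U). split; [specialize (Hcol1 U HU); lia|].
    intros a Ha. exists U. repeat split; auto. apply HB.
    (* The supremum in [L_at] runs over all members, so [U z] is itself read off from the inclusion
       of the ball. *)
    rewrite (proj2 (proj1 (proj2 Hd) z z) eq_refl).
    rewrite Rmult_assoc. now apply Rmult_lt_0_compat.
Qed.

Lemma colour_cover_weaken E n n' sigma tau sigma' tau' :
  (n <= n')%nat -> sigma' <= sigma -> tau <= tau' ->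
  colour_cover d E n sigma tau -> colour_cover d E n' sigma' tau'.
Proof.
  intros Hn Hsig Htau (A & B & C & D). repeat split; auto.
  - intros i z a H. specialize (C i z a H). lra.
  - intros z. destruct (D z) as (i & Hi & Ha). exists i. split; [lia|].
    intros a Hl. apply Ha. lra.
Qed.

Lemma cdim_small_scales m :
  cdim_le d m -> inhabited Z /\
  exists c tau0, 0 < c /\ 0 < tau0 /\ forall tau, 0 < tau < tau0 ->
    exists E, colour_cover d E (m + 1) (c * tau) tau.
Proof.
  intros (m' & Hm & l & Hlim & Hl).
  destruct (Hlim (l / 2) ltac:(lra)) as (eta & Heta & H).
  set (delta := Rmin eta 1 / 2).
  assert (Hmin : 0 < Rmin eta 1) by (apply Rmin_glb_lt; lra).
  assert (Hm1 := Rmin_l eta 1). assert (Hm2 := Rmin_r eta 1).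
  assert (Hdelta : 0 < delta) by (unfold delta; lra).
  destruct (H delta Hdelta ltac:(unfold delta; lra) ltac:(unfold delta; lra)) as [H1 _].
  (* The limit gives the lower bound [l / 2]; lowering it to [l / 4] makes the inequality strict, so
     that witnesses can be drawn from the suprema. *)
  assert (H2 : Rbar_lt (l / 4) (c_delta d m' delta)).
  { eapply Rbar_lt_le_trans; [|exact H1]. simpl. lra. }
  destruct (Rbar_lub_ex _ _ H2) as (r & (eps & Heps & ->) & Hr).
  assert (Hgood : forall tau, 0 < tau < eps ->
    exists cov, good_cover d m' delta tau cov /\ Rbar_lt (l / 4) (cap d cov)).
  { intros tau Ht.
    assert (K : Rbar_lt (l / 4) (c_tau d m' delta tau)).
    { eapply Rbar_lt_le_trans; [exact Hr|]. apply Rbar_glb_le. exists tau. auto. }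
    destruct (Rbar_lub_ex _ _ K) as (r & [[-> _]|(cov & Hc & ->)] & Hr').
    - simpl in Hr'. lra.
    - eauto. }
  split.
  - destruct (Hgood (eps / 2) ltac:(lra)) as (cov & Hc & _).
    apply (good_cover_inhabited m' delta (eps / 2) cov); auto.
    apply Rmult_lt_0_compat; lra.
  - exists (l / 4 * delta), eps. split; [apply Rmult_lt_0_compat; lra|].
    split; [auto|]. intros tau Ht. destruct (Hgood tau Ht) as (cov & Hc & Hcap).
    destruct (good_cover_colour_cover m' delta tau (l / 4) cov) as (E & HE); auto.
    { apply Rmult_lt_0_compat; lra. } { lra. }
    exists E. refine (colour_cover_weaken E _ _ _ _ _ _ _ _ _ HE); [lia|lra|lra].
Qed.

(** Below [B] a covering of the smaller scale [q * tau] serves, at the cost of the factor [q] in the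
    Lebesgue number. From [B] on, the single set [Z] serves. *)
Lemma colour_cover_all_scales n B c tau0 :
  (0 < n)%nat -> 0 < B -> (forall x y, d x y <= B) -> 0 < c -> 0 < tau0 ->
  (forall tau, 0 < tau < tau0 -> exists E, colour_cover d E n (c * tau) tau) ->
  exists c', 0 < c' /\ forall tau, 0 < tau -> exists E,
    colour_cover d E n (c' * tau) tau /\
    (B <= tau -> forall i z a, E i z a <-> i = 0%nat).
Proof.
  intros Hn HB Hdiam Hc Ht0 H.
  (* For [tau < B] this gives [q * tau < tau0], and [q <= 1] keeps the mesh below [tau]. *)
  set (q := Rmin 1 (tau0 / (2 * B))).
  assert (Hq0 : 0 < q).
  { apply Rmin_glb_lt; [lra|]. apply Rdiv_lt_0_compat; lra. }
  assert (Hq1 : q <= 1) by apply Rmin_l.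
  assert (Hq2 : q * (2 * B) <= tau0).
  { replace tau0 with (tau0 / (2 * B) * (2 * B)) by (field; lra).
    apply Rmult_le_compat_r; [lra|]. apply Rmin_r. }
  exists (c * q). split; [now apply Rmult_lt_0_compat|]. intros tau Ht.
  destruct (Rle_lt_dec B tau) as [h|h].
  - exists (fun i _ _ => i = 0%nat). split; [|tauto].
    repeat split; auto.
    + intros i z a _. specialize (Hdiam z a). lra.
    + intros z. exists 0%nat. auto.
  - destruct (H (q * tau)) as (E & HE).
    { split; [now apply Rmult_lt_0_compat|]. nra. }
    exists E. split; [|lra].
    refine (colour_cover_weaken E _ _ _ _ _ _ _ _ _ HE); [lia|lra|nra].
Qed.
End Covers.

(** * Mapping cylinders of nerves *)

Lemma Rmin_lipschitz x y a b : Rabs (Rmin x a - Rmin y b) <= Rabs (x - y) + Rabs (a - b).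
Proof.
  unfold Rmin, Rabs.
  repeat destruct (Rle_dec _ _); repeat destruct (Rcase_abs _); lra.
Qed.

Lemma Rabs_mult_diff a b x y :
  0 <= b <= 1 -> 0 <= x <= 1 -> Rabs (a * x - b * y) <= Rabs (a - b) + Rabs (x - y).
Proof.
  intros Hb Hx. replace (a * x - b * y) with ((a - b) * x + b * (x - y)) by ring.
  eapply Rle_trans; [apply Rabs_triang|]. rewrite !Rabs_mult.
  rewrite (Rabs_pos_eq b), (Rabs_pos_eq x) by lra.
  assert (A := Rabs_pos (a - b)). assert (B := Rabs_pos (x - y)).
  nra.
Qed.

Section Prism.
Implicit Types (u : nat -> R) (b : R) (i : nat).

Definition cumul u i : R := sum_over (seq 0 i) u.

(* The length of the intersection of [0, b] with the i-th interval of the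
   subdivision of [0, 1] into consecutive intervals of lengths u 0, u 1, ... *)
Definition filled u b i : R := Rmin (cumul u (S i)) b - Rmin (cumul u i) b.

Lemma cumul_S u i : cumul u (S i) = cumul u i + u i.
Proof. unfold cumul. rewrite seq_S, sum_over_app. simpl. ring. Qed.

Lemma cumul_mono u n i j :
  (forall k, (k < n)%nat -> 0 <= u k) -> (i <= j <= n)%nat -> cumul u i <= cumul u j.
Proof.
  intros Hu [Hij Hj]. induction Hij as [|j Hij IH]; [lra|].
  rewrite cumul_S. specialize (IH ltac:(lia)). specialize (Hu j ltac:(lia)). lra.
Qed.

Lemma filled_bounds u b i : 0 <= u i -> 0 <= filled u b i <= u i.
Proof.
  unfold filled. rewrite cumul_S. intros H.
  unfold Rmin. repeat destruct (Rle_dec _ _); lra.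
Qed.

Lemma filled_lipschitz_r u b b' i :
  Rabs (filled u b i - filled u b' i) <= 2 * Rabs (b - b').
Proof.
  unfold filled.
  assert (H1 := Rmin_lipschitz (cumul u (S i)) (cumul u (S i)) b b').
  assert (H2 := Rmin_lipschitz (cumul u i) (cumul u i) b b').
  rewrite Rminus_diag, Rabs_R0 in H1, H2.
  match goal with |- Rabs (?x - ?y - (?x' - ?y')) <= _ =>
    replace (x - y - (x' - y')) with ((x - x') - (y - y')) by ring end.
  eapply Rle_trans; [apply Rabs_triang|]. rewrite Rabs_Ropp. lra.
Qed.

Lemma cumul_diff u u' n delta i :
  (forall j, (j < n)%nat -> Rabs (u j - u' j) <= delta) -> (i <= n)%nat -> 0 <= delta ->
  Rabs (cumul u i - cumul u' i) <= INR n * delta.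
Proof.
  intros H Hi Hd. unfold cumul. rewrite <- sum_over_minus.
  eapply Rle_trans; [apply sum_over_abs|].
  apply Rle_trans with (sum_over (seq 0 i) (fun _ => delta)).
  - apply sum_over_le. intros j Hj. apply in_seq in Hj. apply H. lia.
  - rewrite sum_over_const, length_seq. apply Rmult_le_compat_r; auto. now apply le_INR.
Qed.

Lemma filled_lipschitz_l u u' n delta b i :
  (forall j, (j < n)%nat -> Rabs (u j - u' j) <= delta) -> (i < n)%nat -> 0 <= delta ->
  Rabs (filled u b i - filled u' b i) <= 2 * INR n * delta.
Proof.
  intros H Hi Hd. unfold filled.
  assert (H1 := Rmin_lipschitz (cumul u (S i)) (cumul u' (S i)) b b).
  assert (H2 := Rmin_lipschitz (cumul u i) (cumul u' i) b b).
  assert (H3 := cumul_diff u u' n delta i H ltac:(lia) Hd).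
  assert (H4 := cumul_diff u u' n delta (S i) H ltac:(lia) Hd).
  rewrite Rminus_diag, Rabs_R0 in H1, H2.
  match goal with |- Rabs (?x - ?y - (?x' - ?y')) <= _ =>
    replace (x - y - (x' - y')) with ((x - x') - (y - y')) by ring end.
  eapply Rle_trans; [apply Rabs_triang|]. rewrite Rabs_Ropp. lra.
Qed.

Context (u : nat -> R) (n : nat).
Context (Hu : forall k, (k < n)%nat -> 0 <= u k) (H1 : cumul u n = 1).

Lemma filled_0 i : (i < n)%nat -> filled u 0 i = 0.
Proof.
  intros Hi. unfold filled.
  assert (A := cumul_mono u n 0 i Hu ltac:(lia)).
  assert (B := cumul_mono u n 0 (S i) Hu ltac:(lia)).
  change (cumul u 0) with 0 in *. rewrite !Rmin_right; lra.
Qed.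

Lemma filled_1 i : (i < n)%nat -> filled u 1 i = u i.
Proof.
  intros Hi. unfold filled.
  assert (A := cumul_mono u n i n Hu ltac:(lia)).
  assert (B := cumul_mono u n (S i) n Hu ltac:(lia)).
  rewrite !Rmin_left by lra. rewrite cumul_S. ring.
Qed.

(** The point [b] falls into the interval [i0]: the intervals before it are full, those after it are
    empty, and only [i0] can be filled in part. This is what bounds the number of vertices of a
    prism simplex. *)
Lemma filled_pivot b :
  0 < b -> exists i0, (i0 < n)%nat /\
    forall i, (i < n)%nat -> (filled u b i <> 0 -> (i <= i0)%nat) /\
                             (filled u b i <> u i -> (i0 <= i)%nat).
Proof.
  intros Hb.
  (* The pivot is the last interval whose left end lies strictly below [b], found by descending from
     the last interval. *)
  assert (Hx : exists i0, (i0 < n)%nat /\ cumul u i0 < b /\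
    forall i, (i0 < i < n)%nat -> b <= cumul u i).
  { assert (Hn : (0 < n)%nat).
    { destruct n; [|lia]. unfold cumul in H1. simpl in H1. lra. }
    clear H1. revert Hn Hu. generalize n as p. induction p as [|p IH]; [lia|].
    intros _ Hp. destruct p as [|p].
    - exists 0%nat. unfold cumul. simpl. split; [lia|]. split; [lra|]. lia.
    - destruct (Rlt_le_dec (cumul u (S p)) b) as [Hl|Hl].
      + exists (S p). split; [lia|]. split; [auto|]. lia.
      + destruct IH as (i0 & Hi0 & Ha & Hr); [lia|intros; apply Hp; lia|].
        exists i0. split; [lia|]. split; [auto|]. intros i Hi.
        destruct (Nat.eq_dec i (S p)) as [->|]; [auto|]. apply Hr. lia. }
  destruct Hx as (i0 & Hi0 & Ha & Hr). exists i0. split; [auto|].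
  intros i Hi. split; intros Hf; apply Nat.nlt_ge; intros Hlt; apply Hf.
  - specialize (Hr i ltac:(lia)). assert (M := cumul_mono u n i (S i) Hu ltac:(lia)).
    unfold filled. rewrite !Rmin_right by lra. ring.
  - assert (M := cumul_mono u n i (S i) Hu ltac:(lia)).
    assert (M' := cumul_mono u n (S i) i0 Hu ltac:(lia)).
    unfold filled. rewrite !Rmin_left by lra. rewrite cumul_S. ring.
Qed.
End Prism.

(** * One cell of the telescope, between levels [k] and [S k] *)

Section Cell.
Context {Z : Type} (d : Z -> Z -> R) (Hd : is_metric d) (Zi : inhabited Z).
Context (n : nat) (E : nat -> nat -> Z -> Z -> Prop) (sigma tau : nat -> R).
Context (HE : forall k, colour_cover d (E k) n (sigma k) (tau k)).
Context (Hs : forall k, 0 < sigma k) (Hst : forall k, tau (S k) < sigma k).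

(* level, colour, class *)
Definition vertex : Type := nat * nat * (Z -> Prop).

Definition wt k z i : R := weight d (E k) n (sigma k) i z.
Definition label k z i : vertex := (k, i, E k i z).

(* A class of level [k] containing the given set, provided that it is a
   nonempty class of level [S k]. *)
Definition parent k (U : Z -> Prop) : vertex :=
  let z0 := epsilon Zi U in
  label k z0 (epsilon (inhabits 0%nat)
    (fun j => (j < n)%nat /\ forall a, d z0 a < sigma k -> E k j z0 a)).

(** The tag [None] marks the level-[k] coordinates, [Some false] the part of the level-[S k]
    coordinates placed at parents, and [Some true] the part placed at the classes themselves. *)
Definition cell_index : list (option bool * nat) :=
  list_prod (None :: Some false :: Some true :: nil) (seq 0 n).

(* For s in [0, 1/2] the level-k barycentric coordinates are moved linearly to
   the parents of the level-(k+1) ones; for s in [1/2, 1] the mass then moves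
   up to level k+1 colour after colour, through the prism triangulation of the
   mapping cylinder of [parent]. *)
Definition phase1 (s : R) : R := Rmin (2 * s) 1.
Definition phase2 (s : R) : R := Rmax (2 * s - 1) 0.

Definition cell_weight k z s (x : option bool * nat) : R :=
  let (c, i) := x in
  match c with
  | None => (1 - phase1 s) * wt k z i
  | Some false => phase1 s * (wt (S k) z i - filled (wt (S k) z) (phase2 s) i)
  | Some true => phase1 s * filled (wt (S k) z) (phase2 s) i
  end.

Definition cell_vertex k z (x : option bool * nat) : vertex :=
  let (c, i) := x in
  match c with
  | None => label k z i
  | Some false => parent k (E (S k) i z)
  | Some true => label (S k) z i
  end.

Definition cell k z s : vertex -> R :=
  mass cell_index (cell_weight k z s) (cell_vertex k z).

Lemma in_cell_index c i : In (c, i) cell_index <-> (i < n)%nat.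
Proof.
  unfold cell_index. rewrite in_prod_iff, in_seq.
  destruct c as [[|]|]; simpl; intuition (auto; lia).
Qed.

Lemma length_cell_index : INR (length cell_index) = 3 * INR n.
Proof.
  unfold cell_index. rewrite length_prod, length_seq, mult_INR. simpl. ring.
Qed.

Lemma sum_cell_index f :
  sum_over cell_index f =
  sum_over (seq 0 n) (fun i => f (None, i) + f (Some false, i) + f (Some true, i)).
Proof.
  unfold cell_index. rewrite sum_over_prod, !sum_over_plus. simpl. ring.
Qed.

Lemma wt_nonneg k z i : 0 <= wt k z i.
Proof. now apply (weight_nonneg d Hd _ _ _ _ (HE k)). Qed.

Lemma wt_sum k z : cumul (wt k z) n = 1.
Proof. now apply (weight_sum d Hd _ _ _ _ (HE k)). Qed.

Lemma wt_le_1 k z i : (i < n)%nat -> wt k z i <= 1.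
Proof.
  intros Hi. rewrite <- (wt_sum k z). apply (sum_over_ge_term (seq 0 n) (wt k z)).
  - intros; apply wt_nonneg.
  - apply in_seq; lia.
Qed.

Lemma filled_wt k z b i : 0 <= filled (wt k z) b i <= wt k z i.
Proof. apply filled_bounds, wt_nonneg. Qed.

(** The representative [z0] of the class is within [tau (S k) < sigma k] of [z], so the level-[k]
    class containing the ball at [z0] also contains [z]. *)
Lemma parent_label k z i :
  E (S k) i z z -> exists j, (j < n)%nat /\ parent k (E (S k) i z) = label k z j /\
    E k j z z.
Proof.
  intros Hz. unfold parent.
  assert (Hz0 := epsilon_spec Zi (E (S k) i z) (ex_intro _ z Hz)).
  set (z0 := epsilon Zi _) in *.
  assert (Hj := epsilon_spec (inhabits 0%nat)
    (fun j => (j < n)%nat /\ forall a, d z0 a < sigma k -> E k j z0 a)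
    (proj2 (proj2 (proj2 (HE k))) z0)).
  set (j := epsilon (inhabits 0%nat) _) in *. destruct Hj as [Hj Ha].
  assert (H : E k j z0 z).
  { apply Ha. eapply Rle_lt_trans; [|apply (Hst k)]. apply (HE (S k)) with i.
    now apply (HE (S k)). }
  exists j. split; [auto|]. unfold label.
  rewrite (class_eq d (E k) n _ _ (HE k) _ _ _ H). split; [reflexivity|].
  destruct (HE k) as (Sy & Tr & _). eauto.
Qed.

Lemma phase_bounds s : 0 <= s <= 1 -> 0 <= phase1 s <= 1 /\ 0 <= phase2 s <= 1.
Proof.
  intros H. unfold phase1, phase2, Rmin, Rmax. repeat destruct (Rle_dec _ _); lra.
Qed.

Lemma cell_weight_nonneg k z s x : 0 <= s <= 1 -> 0 <= cell_weight k z s x.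
Proof.
  intros H. destruct (phase_bounds s H) as [P1 P2]. destruct x as [c i].
  assert (A := wt_nonneg k z i). assert (B := filled_wt (S k) z (phase2 s) i).
  destruct c as [[|]|]; simpl; apply Rmult_le_pos; lra.
Qed.

Lemma cell_weight_sum k z s : sum_over cell_index (cell_weight k z s) = 1.
Proof.
  rewrite sum_cell_index. simpl.
  rewrite (sum_over_ext _ _ (fun i => (1 - phase1 s) * wt k z i
     + phase1 s * wt (S k) z i)) by (intros; ring).
  rewrite sum_over_plus, !sum_over_scal.
  change (sum_over (seq 0 n) (wt ?k z)) with (cumul (wt k z) n).
  rewrite !wt_sum. ring.
Qed.

Lemma cell_nonneg k z s v : 0 <= s <= 1 -> 0 <= cell k z s v.
Proof. intros H. apply mass_nonneg. intros. now apply cell_weight_nonneg. Qed.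

Lemma cell_total k z s L :
  0 <= s <= 1 -> NoDup L -> (forall v, cell k z s v <> 0 -> In v L) ->
  sum_over L (cell k z s) = 1.
Proof.
  intros H HL HS. rewrite <- (cell_weight_sum k z s). apply mass_total; auto.
  intros x Hx Hw. apply HS. apply mass_support_in; auto.
  intros. now apply cell_weight_nonneg.
Qed.

(** A nonzero cell weight forces the underlying partition weight to be nonzero, so the class in
    question contains [z]; parents are classes of [z] by [parent_label]. *)
Lemma cell_vertex_label k z s x :
  In x cell_index -> cell_weight k z s x <> 0 ->
  exists k' i, (k' = k \/ k' = S k) /\ (i < n)%nat /\ E k' i z z /\
    cell_vertex k z x = label k' z i /\ (fst x <> Some true -> k' = k).
Proof.
  destruct x as [c i]. rewrite in_cell_index. intros Hi Hw.
  destruct c as [[|]|]; simpl in Hw |- *.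
  - exists (S k), i. repeat split; auto; [|congruence].
    apply (weight_support d Hd _ _ _ _ (HE (S k)) (Hs _)). intros h. apply Hw.
    assert (B := filled_wt (S k) z (phase2 s) i). unfold wt in *. rewrite h in B.
    replace (filled _ _ _) with 0 by (unfold wt; lra). ring.
  - destruct (parent_label k z i) as (j & Hj & He & Hzz).
    + apply (weight_support d Hd _ _ _ _ (HE (S k)) (Hs _)). intros h. apply Hw.
      assert (B := filled_wt (S k) z (phase2 s) i). unfold wt in *. rewrite h in B.
      rewrite h. replace (filled _ _ _) with 0 by (unfold wt; lra). ring.
    + exists k, j. repeat split; auto.
  - exists k, i. repeat split; auto.
    apply (weight_support d Hd _ _ _ _ (HE k) (Hs _)). intros h. apply Hw.
    unfold wt. rewrite h. ring.
Qed.

Lemma cell_support k z s v :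
  cell k z s v <> 0 ->
  exists k' i, (k' = k \/ k' = S k) /\ E k' i z z /\ v = label k' z i.
Proof.
  intros H. destruct (mass_support _ _ _ _ H) as (x & Hx & <- & Hw).
  destruct (cell_vertex_label k z s x Hx Hw) as (k' & i & A & _ & B & C & _).
  eauto.
Qed.

(** The dimension count. In the first half of the cell only the at most [n] level-[k] classes of [z]
    carry mass; in the second half the colours are split at the pivot between the two levels. *)
Lemma cell_support_card k z s L :
  0 <= s <= 1 -> NoDup L -> (forall v, In v L -> cell k z s v <> 0) ->
  (length L <= n + 1)%nat.
Proof.
  intros Hs01 HL Hsup.
  destruct (Rle_or_lt s (1/2)) as [Hh|Hh].
  - replace (n + 1)%nat with (S (length (map (label k z) (seq 0 n))))
      by (rewrite length_map, length_seq; lia).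
    apply le_S, NoDup_incl_length; auto. intros v Hv.
    destruct (mass_support _ _ _ _ (Hsup v Hv)) as (x & Hx & <- & Hw).
    destruct (cell_vertex_label k z s x Hx Hw) as (k' & i & A & Hi & B & C & D).
    rewrite C, D.
    + apply in_map. apply in_seq. lia.
    (* In the first half [phase2 s = 0], so nothing has moved up to level [S k] yet. *)
    + destruct x as [c j]. simpl. intros ->. apply Hw. simpl.
      apply in_cell_index in Hx.
      replace (phase2 s) with 0 by (unfold phase2; rewrite Rmax_right; lra).
      rewrite (filled_0 _ n); auto; [ring|]. intros; apply wt_nonneg.
  - assert (P1 : phase1 s = 1) by (unfold phase1; rewrite Rmin_right; lra).
    assert (P2 : 0 < phase2 s) by (unfold phase2; rewrite Rmax_left; lra).
    destruct (filled_pivot (wt (S k) z) n) with (b := phase2 s)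
      as (i0 & Hi0 & Hpiv); auto.
    { intros; apply wt_nonneg. } { apply wt_sum. }
    (* Colours up to [i0] at level [S k] and colours from [i0] on at parents: only the pivot colour
       counts twice, which is the one extra dimension. *)
    replace (n + 1)%nat with (length (map (label (S k) z) (seq 0 (S i0)) ++
       map (fun i => parent k (E (S k) i z)) (seq i0 (n - i0))))
      by (rewrite length_app, !length_map, !length_seq; lia).
    apply NoDup_incl_length; auto. intros v Hv. apply in_or_app.
    destruct (mass_support _ _ _ _ (Hsup v Hv)) as ([c i] & Hx & <- & Hw).
    apply in_cell_index in Hx. destruct (Hpiv i Hx) as [Q1 Q2].
    destruct c as [[|]|]; simpl in Hw; rewrite P1 in Hw.
    + left. apply (in_map (label (S k) z)), in_seq. assert (i <= i0)%nat; [|lia].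
      apply Q1. intros h. apply Hw. rewrite h. ring.
    + right. apply (in_map (fun i => parent k (E (S k) i z))), in_seq.
      assert (i0 <= i)%nat; [|lia]. apply Q2. intros h. apply Hw. rewrite h. ring.
    + exfalso. apply Hw. ring.
Qed.

(** At [s = 1] all mass sits at the level-[S k] classes with their own weights, which is the [None]
    part with which the next cell starts. *)
Lemma cell_junction k z v : cell k z 1 v = cell (S k) z 0 v.
Proof.
  unfold cell, mass. rewrite !sum_cell_index. apply sum_over_ext.
  intros i Hi. apply in_seq in Hi. simpl.
  replace (phase1 1) with 1 by (unfold phase1; rewrite Rmin_right; lra).
  replace (phase2 1) with 1 by (unfold phase2; rewrite Rmax_left; lra).
  replace (phase1 0) with 0 by (unfold phase1; rewrite Rmin_left; lra).
  rewrite (filled_1 _ n); [|intros; apply wt_nonneg|apply wt_sum|lia].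
  repeat destruct (excluded_middle_informative _); ring.
Qed.

Lemma cell_radial k z s s' L :
  0 <= s <= 1 -> 0 <= s' <= 1 -> NoDup L ->
  sum_over L (fun v => Rabs (cell k z s v - cell k z s' v)) <=
  18 * INR n * Rabs (s - s').
Proof.
  intros H H' HL.
  (* There are [3 * INR n] indices. Each weight has constant at most 6: 2 from [phase1], and 4 from
     [filled], which has constant 2 in [phase2], itself of constant 2. *)
  replace (18 * INR n * Rabs (s - s')) with
    (INR (length cell_index) * (6 * Rabs (s - s')))
    by (rewrite length_cell_index; ring).
  apply mass_l1_le; auto. intros [c i] Hx. apply in_cell_index in Hx.
  left. split; [reflexivity|].
  assert (P1 : Rabs (phase1 s - phase1 s') <= 2 * Rabs (s - s')).
  { assert (K := Rmin_lipschitz (2 * s) (2 * s') 1 1).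
    rewrite Rminus_diag, Rabs_R0 in K. fold (phase1 s) (phase1 s') in K.
    replace (2 * s - 2 * s') with (2 * (s - s')) in K by ring.
    rewrite Rabs_mult, (Rabs_pos_eq 2) in K by lra. lra. }
  assert (P2 : Rabs (phase2 s - phase2 s') <= 2 * Rabs (s - s')).
  { unfold phase2, Rmax, Rabs.
    repeat destruct (Rle_dec _ _); repeat destruct (Rcase_abs _); lra. }
  assert (F := filled_lipschitz_r (wt (S k) z) (phase2 s) (phase2 s') i).
  assert (W0 := wt_nonneg k z i). assert (W1 := wt_le_1 k z i Hx).
  assert (W0' := wt_nonneg (S k) z i). assert (W1' := wt_le_1 (S k) z i Hx).
  assert (B := filled_wt (S k) z (phase2 s) i).
  assert (B' := filled_wt (S k) z (phase2 s') i).
  destruct (phase_bounds s H) as [Q1 Q2]. destruct (phase_bounds s' H') as [Q1' Q2'].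
  assert (Ab := Rabs_pos (s - s')).
  destruct c as [[|]|]; simpl;
    (eapply Rle_trans; [apply Rabs_mult_diff; lra|]).
  - lra.
  - match goal with |- _ + Rabs (?x - ?y - (?x - ?y')) <= _ =>
      replace (x - y - (x - y')) with (- (y - y')) by ring end.
    rewrite Rabs_Ropp. lra.
  - rewrite Rminus_diag, Rabs_R0.
    replace (1 - phase1 s - (1 - phase1 s')) with (- (phase1 s - phase1 s')) by ring.
    rewrite Rabs_Ropp. lra.
Qed.

(** If [z] and [z'] share the class of an index, the target is the same, since [parent] depends on
    the class only; otherwise both weights are small. The factor [2 * INR n + 1] is the variation of
    a weight plus that of its filled part. *)
Lemma cell_horizontal k z z' s delta L :
  (forall k', k' = k \/ k' = S k -> forall i, (i < n)%nat ->
     Rabs (wt k' z i - wt k' z' i) <= delta /\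
     (E k' i z <> E k' i z' -> wt k' z i + wt k' z' i <= delta)) ->
  0 <= delta -> 0 <= s <= 1 -> NoDup L ->
  sum_over L (fun v => Rabs (cell k z s v - cell k z' s v)) <=
  3 * INR n * (2 * INR n + 1) * delta.
Proof.
  intros H Hdel Hs01 HL.
  replace (3 * INR n * (2 * INR n + 1) * delta) with
    (INR (length cell_index) * ((2 * INR n + 1) * delta))
    by (rewrite length_cell_index; ring).
  apply mass_l1_le; auto. intros [c i] Hx.
  destruct (phase_bounds s Hs01) as [Q1 Q2].
  rewrite !(Rabs_pos_eq (cell_weight k _ s (c, i))) by now apply cell_weight_nonneg.
  apply in_cell_index in Hx.
  destruct (H k (or_introl eq_refl) i Hx) as [A1 A2].
  destruct (H (S k) (or_intror eq_refl) i Hx) as [B1 B2].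
  assert (F := filled_lipschitz_l (wt (S k) z) (wt (S k) z') n delta (phase2 s) i
    (fun j Hj => proj1 (H (S k) (or_intror eq_refl) j Hj)) Hx Hdel).
  assert (Fz := filled_wt (S k) z (phase2 s) i).
  assert (Fz' := filled_wt (S k) z' (phase2 s) i).
  assert (Wz := wt_nonneg k z i). assert (Wz' := wt_nonneg k z' i).
  assert (N := pos_INR n). assert (ND : 0 <= INR n * delta) by now apply Rmult_le_pos.
  destruct c as [[|]|]; simpl.
  - destruct (classic (E (S k) i z = E (S k) i z')) as [e|e]; [left|right].
    + split; [unfold label; now rewrite e|].
      rewrite <- Rmult_minus_distr_l, Rabs_mult, Rabs_pos_eq by lra.
      assert (K := Rabs_pos (filled (wt (S k) z) (phase2 s) i
        - filled (wt (S k) z') (phase2 s) i)). nra.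
    + specialize (B2 e). nra.
  - destruct (classic (E (S k) i z = E (S k) i z')) as [e|e]; [left|right].
    + split; [now rewrite e|].
      rewrite <- Rmult_minus_distr_l, Rabs_mult, Rabs_pos_eq by lra.
      match goal with |- _ * Rabs ?x <= _ =>
        assert (K := Rabs_pos x); assert (K2 : Rabs x <= (2 * INR n + 1) * delta) end.
      { match goal with |- Rabs (?x - ?y - (?x' - ?y')) <= _ =>
          replace (x - y - (x' - y')) with ((x - x') - (y - y')) by ring end.
        eapply Rle_trans; [apply Rabs_triang|]. rewrite Rabs_Ropp. lra. }
      nra.
    + specialize (B2 e). nra.
  - destruct (classic (E k i z = E k i z')) as [e|e]; [left|right].
    + split; [unfold label; now rewrite e|].
      rewrite <- Rmult_minus_distr_l, Rabs_mult, Rabs_pos_eq by lra.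
      assert (K := Rabs_pos (wt k z i - wt k z' i)). nra.
    + specialize (A2 e). nra.
Qed.

(** Both functions are nonnegative of total mass at most 1 on [L]. This settles the Lipschitz
    estimate for points far apart. *)
Lemma cell_l1_le_2 k z s k' z' s' L :
  0 <= s <= 1 -> 0 <= s' <= 1 -> NoDup L ->
  sum_over L (fun v => Rabs (cell k z s v - cell k' z' s' v)) <= 2.
Proof.
  intros H H' HL.
  apply Rle_trans with (sum_over L (fun v => cell k z s v + cell k' z' s' v)).
  - apply sum_over_le. intros v _.
    assert (A := cell_nonneg k z s v H). assert (B := cell_nonneg k' z' s' v H').
    apply Rabs_le. lra.
  - rewrite sum_over_plus.
    assert (A : forall k z s, 0 <= s <= 1 -> sum_over L (cell k z s) <= 1).
    { intros p y r Hr. rewrite <- (cell_weight_sum p y r). apply mass_total_le; auto.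
      intros. now apply cell_weight_nonneg. }
    apply Rle_trans with (1 + 1); [|lra]. apply Rplus_le_compat; auto.
Qed.

Lemma cell_finite_support k z s :
  0 <= s <= 1 ->
  exists L, NoDup L /\ L <> nil /\ (forall v, In v L <-> cell k z s v <> 0).
Proof.
  intros H.
  set (L := filter (fun v => if Req_EM_T (cell k z s v) 0 then false else true)
    (nodup (fun x y => excluded_middle_informative (x = y))
       (map (cell_vertex k z) cell_index))).
  assert (HL : forall v, In v L <-> cell k z s v <> 0).
  { intros v. unfold L. rewrite filter_In, nodup_In.
    destruct (Req_EM_T (cell k z s v) 0) as [e|e]; split; try tauto.
    - intros [_ h]. discriminate.
    - intros _. split; [|reflexivity].
      destruct (mass_support _ _ _ _ e) as (x & Hx & <- & _). now apply in_map. }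
  assert (HN : NoDup L) by (apply NoDup_filter, NoDup_nodup).
  exists L. repeat split; auto; try apply HL.
  intros h. assert (K := cell_total k z s L H HN (fun v => proj2 (HL v))).
  rewrite h in K. simpl in K. lra.
Qed.

(** * The cells joined along a ray *)

Context (T : R) (HT : 0 < T) (Hn : (0 < n)%nat).

Definition floor_nat (r : R) : nat := Z.to_nat (Int_part r).

Lemma floor_nat_spec r : 0 <= r -> INR (floor_nat r) <= r < INR (floor_nat r) + 1.
Proof.
  intros H. unfold floor_nat. destruct (base_Int_part r) as [A B].
  assert (0 <= Int_part r)%Z.
  { apply Z.lt_succ_r, lt_IZR. rewrite succ_IZR. simpl. lra. }
  rewrite INR_IZR_INZ, Z2Nat.id by auto. lra.
Qed.

Definition level (t : R) : nat := floor_nat (t / T).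
Definition height (t : R) : R := t / T - INR (level t).
Definition cone_map (z : Z) (t : R) : vertex -> R := cell (level t) z (height t).

Lemma level_spec t :
  0 <= t -> INR (level t) * T <= t < (INR (level t) + 1) * T.
Proof.
  intros H. assert (H0 : 0 <= t / T) by (apply Rdiv_le_0_compat; lra).
  assert (K := floor_nat_spec (t / T) H0). fold (level t) in K.
  replace t with (t / T * T) at 2 3 by (field; lra).
  split; [apply Rmult_le_compat_r|apply Rmult_lt_compat_r]; lra.
Qed.

Lemma height_bounds t : 0 <= t -> 0 <= height t <= 1.
Proof.
  intros H. assert (H0 : 0 <= t / T) by (apply Rdiv_le_0_compat; lra).
  assert (K := floor_nat_spec (t / T) H0). unfold height, level. lra.
Qed.

(** Within one cell this is [cell_radial], and for neighbouring cells it is applied on either side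
    of the junction. If the levels differ by two or more, then [t' - t >= T] and the bound 2
    suffices. *)
Lemma cone_map_radial z t t' L :
  0 <= t -> t <= t' -> NoDup L ->
  sum_over L (fun v => Rabs (cone_map z t v - cone_map z t' v)) <=
  18 * INR n / T * (t' - t).
Proof.
  intros Ht Htt HL. unfold cone_map.
  assert (Bt := height_bounds t Ht). assert (Bt' := height_bounds t' ltac:(lra)).
  assert (K := level_spec t Ht). assert (K' := level_spec t' ltac:(lra)).
  assert (N : 1 <= INR n) by (apply (le_INR 1); lia).
  assert (Eh : 18 * INR n / T * (t' - t) = 18 * INR n *
    ((INR (level t') + height t') - (INR (level t) + height t)))
    by (unfold height; field; lra).
  rewrite Eh.
  assert (Hl : (level t <= level t')%nat).
  { apply Nat.lt_succ_r, INR_lt. rewrite S_INR.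
    apply Rmult_lt_reg_r with T; lra. }
  destruct (Nat.eq_dec (level t') (level t)) as [e|e].
  - rewrite e in *. eapply Rle_trans; [apply cell_radial; auto|].
    rewrite Rabs_minus_sym, Rabs_pos_eq; [right; ring|].
    unfold height. rewrite e. apply Rle_minus_r. ring_simplify.
    apply Rplus_le_reg_r with (INR (level t)). ring_simplify.
    apply Rmult_le_compat_r; [left; now apply Rinv_0_lt_compat|auto].
  - destruct (Nat.eq_dec (level t') (S (level t))) as [e1|e1].
    + eapply Rle_trans;
        [apply (sum_over_l1_triangle _ _ (cell (level t) z 1))|].
      rewrite (sum_over_ext _ (fun a => Rabs (cell (level t) z 1 a - _))
        (fun a => Rabs (cell (level t') z 0 a - cell (level t') z (height t') a)))
        by (intros; now rewrite e1, cell_junction).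
      eapply Rle_trans; [apply Rplus_le_compat; apply cell_radial; auto; lra|].
      rewrite (Rabs_minus_sym _ 1), (Rabs_minus_sym 0), !Rabs_pos_eq by lra.
      rewrite e1, S_INR. right. ring.
    + eapply Rle_trans; [apply cell_l1_le_2; auto|].
      assert (INR (level t) + 2 <= INR (level t')).
      { change 2 with (INR 2). rewrite <- plus_INR. apply le_INR. lia. }
      assert (1 <= (INR (level t') + height t') - (INR (level t) + height t)) by lra.
      nra.
Qed.
End Cell.

(** * Geometry of the hyperbolic cone *)

Lemma exp_le_compat a b : a <= b -> exp a <= exp b.
Proof. intros [l| ->]; [left; now apply exp_increasing|lra]. Qed.

Lemma cosh_minus x y : cosh (x - y) = cosh x * cosh y - sinh x * sinh y.
Proof.
  unfold cosh, sinh.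
  replace (- (x - y)) with (- x + y) by ring. unfold Rminus at 1.
  rewrite !exp_plus. field.
Qed.

Lemma cosh_half x : cosh x = 1 + 2 * (sinh (x / 2)) ^ 2.
Proof.
  unfold cosh, sinh.
  replace x with (x / 2 + x / 2) at 1 2 by field. rewrite Ropp_plus_distr, !exp_plus.
  assert (H : exp (x / 2) * exp (- (x / 2)) = 1)
    by (rewrite <- exp_plus, Rplus_opp_r; apply exp_0).
  nra.
Qed.

Lemma sinh_nonneg x : 0 <= x -> 0 <= sinh x.
Proof.
  intros [H|<-]; [|rewrite sinh_0; lra].
  left. rewrite <- sinh_0. now apply sinh_lt.
Qed.

Lemma cosh_opp x : cosh (- x) = cosh x.
Proof. unfold cosh. rewrite Ropp_involutive. lra. Qed.

Lemma cosh_le_inv x y : 0 <= y -> cosh x <= cosh y -> Rabs x <= y.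
Proof.
  intros Hy H. apply Rnot_lt_le. intros Hl.
  assert (Hx : cosh (Rabs x) = cosh x)
    by (unfold Rabs; destruct (Rcase_abs x); [apply cosh_opp|reflexivity]).
  rewrite <- Hx, (cosh_half (Rabs x)), (cosh_half y) in H.
  assert (K := sinh_lt (y / 2) (Rabs x / 2) ltac:(lra)).
  assert (K' := sinh_nonneg (y / 2) ltac:(lra)). nra.
Qed.

Lemma cosh_ge_1 x : 1 <= cosh x.
Proof. rewrite cosh_half. assert (H := pow2_ge_0 (sinh (x / 2))). lra. Qed.

Lemma cosh_le_exp_Rabs x : cosh x <= exp (Rabs x).
Proof.
  unfold cosh, Rabs. destruct (Rcase_abs x) as [h|h].
  - assert (exp x <= exp (- x)) by (apply exp_le_compat; lra). lra.
  - assert (exp (- x) <= exp x) by (apply exp_le_compat; lra). lra.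
Qed.

(** With [r = sqrt (y * y - 1)] one has [(y + r) * (y - r) = 1], so the two exponentials in [cosh]
    are [y + r] and [y - r]. *)
Lemma cosh_arcosh y : 1 <= y -> 0 <= arcosh y /\ cosh (arcosh y) = y.
Proof.
  intros Hy. unfold arcosh.
  assert (H0 : 0 <= y * y - 1) by nra.
  assert (Hs := sqrt_pos (y * y - 1)). assert (Hq := sqrt_sqrt _ H0).
  set (r := sqrt (y * y - 1)) in *. split.
  - rewrite <- ln_1. destruct (Rle_lt_or_eq_dec 1 (y + r)) as [h|h]; [lra| |].
    + left. apply ln_increasing; lra.
    + rewrite <- h. lra.
  - unfold cosh. rewrite exp_Ropp, exp_ln by lra.
    replace (/ (y + r)) with (y - r); [field|].
    apply Rmult_eq_reg_r with (y + r); [|lra]. rewrite Rinv_l by lra. nra.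
Qed.

(** The Taylor bound [x - x ^ 3 / 6 <= sin x] together with [x ^ 2 <= 4]. *)
Lemma sin_ge_third x : 0 <= x <= 2 -> x / 3 <= sin x.
Proof.
  intros H. destruct (pre_sin_bound x 0) as [K _]; [lra|lra|].
  unfold sin_approx, sin_term in K. simpl in K.
  assert (x * (x * x) <= x * 4) by (apply Rmult_le_compat_l; nra).
  lra.
Qed.

Lemma one_minus_cos_half x : 1 - cos x = 2 * (sin (x / 2)) ^ 2.
Proof.
  replace x with (2 * (x / 2)) at 1 by field. rewrite cos_2a_sin. ring.
Qed.

Lemma one_minus_cos_bounds x : 0 <= x <= PI -> x ^ 2 / 18 <= 1 - cos x <= x ^ 2 / 2.
Proof.
  intros H. rewrite one_minus_cos_half. assert (P := PI_4).
  assert (A := sin_ge_third (x / 2) ltac:(lra)).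
  assert (B : sin (x / 2) <= x / 2).
  { destruct (Rle_lt_or_eq_dec 0 x) as [h|h]; [lra| |].
    - left. apply sin_lt_x. lra.
    - subst x. replace (0 / 2) with 0 by field. rewrite sin_0. lra. }
  nra.
Qed.

Lemma sinh_le_exp x : 0 <= x -> sinh x <= x * exp x.
Proof.
  intros H. unfold sinh.
  assert (A := exp_ineq1_le (- (2 * x))).
  assert (B : exp (- x) = exp x * exp (- (2 * x))).
  { rewrite <- exp_plus. f_equal. ring. }
  rewrite B. assert (C := exp_pos x). nra.
Qed.

Lemma sinh_ge_exp x : 1 <= x -> exp x / 4 <= sinh x.
Proof.
  intros H. unfold sinh. assert (A := exp_ineq1_le x).
  assert (exp (- x) <= 1); [|lra].
  rewrite <- exp_0. apply exp_le_compat. lra.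
Qed.

Lemma sinh_le_half_exp x : sinh x <= exp x / 2.
Proof. unfold sinh. assert (A := exp_pos (- x)). lra. Qed.

(** * Distance estimates in the cone *)

Section Cone.
Context {Z : Type} (d : Z -> Z -> R) (Hd : is_metric d) (z0 : Z).

(** Giving the vertex a base point lets one distance formula cover all points: there the angular
    term carries the factor [sinh 0 = 0]. *)
Definition cone_base (x : Cone Z) : Z :=
  match x with None => z0 | Some (z, _) => z end.

Lemma cone_t_nonneg (x : Cone Z) : 0 <= cone_t x.
Proof. destruct x as [[z [t Ht]]|]; simpl; lra. Qed.

(** Treats both cases of the cone at once: if the diameter is 0, then [d] vanishes and [mu = 1]
    gives the angle 0. *)
Lemma cone_angle_scale (Hb : bounded_metric d) :
  exists mu, 0 < mu /\ (forall z z', 0 <= mu * d z z' <= PI) /\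
    forall x x' : Cone Z, 0 < cone_t x -> 0 < cone_t x' ->
      cone_angle d x x' = mu * d (cone_base x) (cone_base x').
Proof.
  destruct Hb as [B HB].
  assert (HD : forall z z', d z z' <= diamZ d).
  { intros z z'. unfold diamZ.
    destruct (Lub_Rbar_correct (fun r => exists x y : Z, r = d x y)) as [H1 H2].
    specialize (H1 (d z z') (ex_intro _ z (ex_intro _ z' eq_refl))).
    specialize (H2 B). destruct (Lub_Rbar _) as [l| |]; simpl in *; auto; try tauto.
    exfalso. apply H2. intros r (x & y & ->). simpl. auto. }
  assert (P := PI_RGT_0).
  destruct (Rlt_dec 0 (diamZ d)) as [h|h].
  - exists (PI / diamZ d). split; [now apply Rdiv_lt_0_compat|]. split.
    + intros z z'. assert (A := proj1 Hd z z'). specialize (HD z z').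
      assert (0 < PI / diamZ d) by now apply Rdiv_lt_0_compat.
      split; [apply Rmult_le_pos; lra|].
      replace PI with (PI / diamZ d * diamZ d) at 2 by (field; lra).
      apply Rmult_le_compat_l; lra.
    + intros [[z t]|] [[z' t']|]; simpl; try lra. intros _ _.
      destruct (Rlt_dec 0 (diamZ d)); [reflexivity|tauto].
  - assert (H0 : forall z z', d z z' = 0).
    { intros z z'. specialize (HD z z'). assert (A := proj1 Hd z z'). lra. }
    exists 1. split; [lra|]. split; [intros; rewrite H0; lra|].
    intros [[z t]|] [[z' t']|]; simpl; try lra. intros _ _.
    destruct (Rlt_dec 0 (diamZ d)); [tauto|]. rewrite H0. ring.
Qed.

(** The law of cosines rearranged into a radial term, at least 1, and a nonnegative angular term.
    This puts the argument of [arcosh] in its domain and lets either term be estimated alone. *)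
Lemma cone_dist_cosh mu :
  (forall x x' : Cone Z, 0 < cone_t x -> 0 < cone_t x' ->
      cone_angle d x x' = mu * d (cone_base x) (cone_base x')) ->
  forall x x' : Cone Z, 0 <= cone_dist d x x' /\
    cosh (cone_dist d x x') = cosh (cone_t x - cone_t x') +
      sinh (cone_t x) * sinh (cone_t x') *
      (1 - cos (mu * d (cone_base x) (cone_base x'))).
Proof.
  intros Hmu x x'. unfold cone_dist.
  replace (cosh (cone_t x) * cosh (cone_t x') - sinh (cone_t x) * sinh (cone_t x') *
    cos (cone_angle d x x')) with (cosh (cone_t x - cone_t x') +
      sinh (cone_t x) * sinh (cone_t x') *
      (1 - cos (mu * d (cone_base x) (cone_base x')))).
  - apply cosh_arcosh.
    assert (A := cosh_ge_1 (cone_t x - cone_t x')).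
    assert (B := sinh_nonneg _ (cone_t_nonneg x)).
    assert (B' := sinh_nonneg _ (cone_t_nonneg x')).
    assert (C := COS_bound (mu * d (cone_base x) (cone_base x'))).
    assert (0 <= sinh (cone_t x) * sinh (cone_t x') *
      (1 - cos (mu * d (cone_base x) (cone_base x')))); [|lra].
    apply Rmult_le_pos; [now apply Rmult_le_pos|lra].
  - rewrite cosh_minus.
    destruct (cone_t_nonneg x) as [h|h];
      [|rewrite <- h, sinh_0; ring].
    destruct (cone_t_nonneg x') as [h'|h'];
      [|rewrite <- h', sinh_0; ring].
    rewrite Hmu by auto. ring.
Qed.

Context (mu : R) (Hmu : 0 < mu) (Hpi : forall z z', 0 <= mu * d z z' <= PI).
Context (Hcosh : forall x x' : Cone Z, 0 <= cone_dist d x x' /\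
    cosh (cone_dist d x x') = cosh (cone_t x - cone_t x') +
      sinh (cone_t x) * sinh (cone_t x') *
      (1 - cos (mu * d (cone_base x) (cone_base x')))).

Lemma cone_dist_ge_radial x x' : Rabs (cone_t x - cone_t x') <= cone_dist d x x'.
Proof.
  destruct (Hcosh x x') as [A B]. apply cosh_le_inv; auto. rewrite B.
  assert (C := COS_bound (mu * d (cone_base x) (cone_base x'))).
  assert (0 <= sinh (cone_t x) * sinh (cone_t x') *
      (1 - cos (mu * d (cone_base x) (cone_base x')))); [|lra].
  apply Rmult_le_pos; [|lra].
  apply Rmult_le_pos; apply sinh_nonneg, cone_t_nonneg.
Qed.

(** Keeping only the angular term gives [(th * exp r) ^ 2 / (18 * 16) <= 2 * sinh (rho / 2) ^ 2],
    hence the constant 24, and then [sinh (rho / 2) <= rho / 2 * exp (rho / 2)]. *)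
Lemma cone_dist_ge_horizontal x x' r :
  1 <= r -> r <= cone_t x -> r <= cone_t x' ->
  mu * d (cone_base x) (cone_base x') * exp r <=
  12 * cone_dist d x x' * exp (cone_dist d x x' / 2).
Proof.
  intros Hr Hx Hx'. destruct (Hcosh x x') as [A B].
  set (rho := cone_dist d x x') in *.
  set (th := mu * d (cone_base x) (cone_base x')) in *.
  assert (Ht : 0 <= th <= PI) by apply Hpi.
  assert (K := proj1 (one_minus_cos_bounds th Ht)).
  assert (C := cosh_ge_1 (cone_t x - cone_t x')). rewrite cosh_half in B.
  assert (S : forall t, r <= t -> exp r / 4 <= sinh t).
  { intros t [h| <-]; [|now apply sinh_ge_exp].
    apply Rle_trans with (sinh r); [now apply sinh_ge_exp|]. left. now apply sinh_lt. }
  assert (P := exp_pos r).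
  assert (S2 : exp r / 4 * (exp r / 4) <= sinh (cone_t x) * sinh (cone_t x')).
  { apply Rmult_le_compat; auto; lra. }
  assert (Hq : th ^ 2 / 18 * (exp r / 4 * (exp r / 4)) <=
     sinh (cone_t x) * sinh (cone_t x') * (1 - cos th)).
  { rewrite Rmult_comm. apply Rmult_le_compat; nra. }
  assert (Hsq : (th * exp r) ^ 2 <= (24 * sinh (rho / 2)) ^ 2) by nra.
  assert (N := sinh_nonneg (rho / 2) ltac:(lra)).
  assert (Hle : th * exp r <= 24 * sinh (rho / 2)).
  { apply Rnot_lt_le. intros h. nra. }
  assert (U := sinh_le_exp (rho / 2) ltac:(lra)). lra.
Qed.

Lemma cone_dist_le x x' r h D :
  0 <= D -> cone_t x <= r -> cone_t x' <= r -> Rabs (cone_t x - cone_t x') <= h ->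
  mu * d (cone_base x) (cone_base x') * exp r <= D ->
  cone_dist d x x' <= 2 * (exp h + D ^ 2).
Proof.
  intros HD Hx Hx' Hh H. destruct (Hcosh x x') as [A B].
  set (rho := cone_dist d x x') in *.
  set (th := mu * d (cone_base x) (cone_base x')) in *.
  assert (Ht : 0 <= th <= PI) by apply Hpi.
  assert (K := one_minus_cos_bounds th Ht).
  assert (C1 := cosh_le_exp_Rabs (cone_t x - cone_t x')).
  assert (C2 := exp_le_compat _ _ Hh).
  assert (S : forall y : Cone Z, cone_t y <= r -> 0 <= sinh (cone_t y) <= exp r).
  { intros y Hy. split; [apply sinh_nonneg, cone_t_nonneg|].
    assert (S1 := sinh_le_half_exp (cone_t y)). assert (S2 := exp_le_compat _ _ Hy).
    assert (P := exp_pos (cone_t y)). lra. }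
  assert (Sx := S x Hx). assert (Sx' := S x' Hx').
  assert (Q : sinh (cone_t x) * sinh (cone_t x') * (1 - cos th) <=
     (exp r * exp r) * (th ^ 2 / 2)).
  { apply Rmult_le_compat; try nra. }
  assert (P := exp_pos r).
  assert (Q2 : (th * exp r) ^ 2 <= D ^ 2) by (apply pow_incr; nra).
  (* A linear lower bound for [cosh] is enough, as only boundedness of fibres is drawn from this
     lemma. *)
  assert (L : (1 + rho) / 2 <= cosh rho).
  { unfold cosh. assert (E1 := exp_ineq1_le rho). assert (E2 := exp_pos (- rho)). lra. }
  nra.
Qed.
End Cone.

(** * The map to a uniform polyhedron *)

Section Map.
Context {Z : Type} (d : Z -> Z -> R) (Hd : is_metric d) (z0 : Z).
Context (mu : R) (Hmu : 0 < mu) (Hpi : forall z z', 0 <= mu * d z z' <= PI).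
Context (Hcosh : forall x x' : Cone Z, 0 <= cone_dist d x x' /\
    cosh (cone_dist d x x') = cosh (cone_t x - cone_t x') +
      sinh (cone_t x) * sinh (cone_t x') *
      (1 - cos (mu * d (cone_base z0 x) (cone_base z0 x')))).
Context (n : nat) (Hn : (0 < n)%nat) (c A T : R).
Context (Hc : 0 < c) (HA : 0 < A) (HT : 1 <= T) (HcT : 1 < c * exp T).

Let tau (k : nat) : R := A * exp (- (INR k * T)).
Let sigma (k : nat) : R := c * tau k.

Context (E : nat -> nat -> Z -> Z -> Prop).
Context (HE : forall k, colour_cover d (E k) n (sigma k) (tau k)).
Context (Htriv : forall k, (k <= 1)%nat -> forall i z a, E k i z a <-> i = 0%nat).

Let f (x : Cone Z) : vertex -> R :=
  cone_map d (inhabits z0) n E sigma T (cone_base z0 x) (cone_t x).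

Lemma scale_pos k : 0 < tau k.
Proof. apply Rmult_lt_0_compat; [auto|apply exp_pos]. Qed.

Lemma lebesgue_pos k : 0 < sigma k.
Proof. apply Rmult_lt_0_compat; [auto|apply scale_pos]. Qed.

Lemma scale_S k : tau (S k) * exp T = tau k.
Proof.
  unfold tau. rewrite Rmult_assoc, <- exp_plus, S_INR. f_equal. f_equal. ring.
Qed.

(** This is where [1 < c * exp T] enters: the mesh of a level is below the Lebesgue number of the
    preceding one, so classes have parents. *)
Lemma scale_S_lt k : tau (S k) < sigma k.
Proof.
  unfold sigma. rewrite <- (scale_S k). assert (P := scale_pos (S k)). nra.
Qed.

Lemma scale_S_le k : tau (S k) <= tau k.
Proof.
  rewrite <- (scale_S k). assert (P := scale_pos (S k)).
  assert (K := exp_ineq1_le T). nra.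
Qed.

Lemma cone_map_in_polyhedron_data x :
  exists S, NoDup S /\ S <> nil /\ (forall v, In v S <-> f x v <> 0) /\
    in_simplex S (f x).
Proof.
  assert (Hh := height_bounds T ltac:(lra) _ (cone_t_nonneg x)).
  destruct (cell_finite_support d Hd (inhabits z0) n E sigma tau HE lebesgue_pos
    (level T (cone_t x)) (cone_base z0 x) (height T (cone_t x)) Hh)
    as (S & HS1 & HS2 & HS3).
  exists S. repeat split; auto; try apply HS3.
  - intros v. apply (cell_nonneg d Hd (inhabits z0) n E sigma tau HE lebesgue_pos); auto.
  - apply (cell_total d Hd (inhabits z0) n E sigma tau HE lebesgue_pos); auto.
    intros v. apply HS3.
Qed.

Lemma cone_map_card x S :
  NoDup S -> (forall v, In v S -> f x v <> 0) -> (length S <= n + 1)%nat.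
Proof.
  intros HS. apply (cell_support_card d Hd (inhabits z0) n E sigma tau HE
    lebesgue_pos scale_S_lt); auto.
  apply height_bounds; [lra|apply cone_t_nonneg].
Qed.

(** A vertex records its level and its class. A common one therefore forces neighbouring or equal
    levels, and puts both base points in one class, of diameter at most the mesh. *)
Lemma cone_map_common_vertex x a v :
  f x v <> 0 -> f a v <> 0 ->
  (level T (cone_t a) <= S (level T (cone_t x)))%nat /\
  (level T (cone_t x) <= S (level T (cone_t a)))%nat /\
  d (cone_base z0 a) (cone_base z0 x) <= tau (level T (cone_t x)).
Proof.
  intros Hx Ha.
  destruct (cell_support d Hd (inhabits z0) n E sigma tau HE lebesgue_pos scale_S_lt
    _ _ _ _ Hx) as (k & i & Hk & Hz & ->).
  destruct (cell_support d Hd (inhabits z0) n E sigma tau HE lebesgue_pos scale_S_lt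
    _ _ _ _ Ha) as (k' & i' & Hk' & Hz' & He).
  unfold label in He. inversion He as [[e1 e2 e3]]. subst k' i'.
  split; [lia|]. split; [lia|].
  apply Rle_trans with (tau k).
  - apply (HE k) with i. rewrite <- e3. exact Hz.
  - destruct Hk as [->| ->]; [lra|apply scale_S_le].
Qed.

Lemma cone_map_bounded_fibres :
  exists D, forall x a b u v,
    f x u <> 0 -> f a u <> 0 -> f x v <> 0 -> f b v <> 0 -> cone_dist d a b <= D.
Proof.
  (* With [k] the level of [x], the radii of [a] and [b] lie between [(k - 1) * T] and
     [(k + 2) * T], and their base points are within [2 * tau k]; the factor [exp (- (k * T))] in
     [tau k] cancels [exp (k * T)]. *)
  exists (2 * (exp (3 * T) + (mu * (2 * A) * exp (2 * T)) ^ 2)).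
  intros x a b u v Hxu Hau Hxv Hbv.
  destruct (cone_map_common_vertex x a u Hxu Hau) as (A1 & A2 & A3).
  destruct (cone_map_common_vertex x b v Hxv Hbv) as (B1 & B2 & B3).
  set (k := level T (cone_t x)) in *.
  assert (La := level_spec T ltac:(lra) _ (cone_t_nonneg a)).
  assert (Lb := level_spec T ltac:(lra) _ (cone_t_nonneg b)).
  apply le_INR in A1, A2, B1, B2. rewrite S_INR in A1, A2, B1, B2.
  set (ka := level T (cone_t a)) in *. set (kb := level T (cone_t b)) in *.
  assert (Ub : forall p, INR p <= INR k + 1 -> (INR p + 1) * T <= (INR k + 2) * T)
    by (intros; apply Rmult_le_compat_r; lra).
  assert (Lw : forall p, INR k <= INR p + 1 -> (INR k - 1) * T <= INR p * T)
    by (intros; apply Rmult_le_compat_r; lra).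
  assert (Ua := Ub ka A1). assert (Ub' := Ub kb B1).
  assert (Lwa := Lw ka A2). assert (Lwb := Lw kb B2).
  apply (cone_dist_le d z0 mu Hpi Hcosh) with (r := (INR k + 2) * T).
  - apply Rmult_le_pos; [nra|left; apply exp_pos].
  - lra.
  - lra.
  - apply Rabs_le. lra.
  - assert (Hab : d (cone_base z0 a) (cone_base z0 b) <= 2 * tau k).
    { destruct Hd as (_ & _ & Sy & Tr).
      specialize (Tr (cone_base z0 a) (cone_base z0 x) (cone_base z0 b)).
      rewrite (Sy (cone_base z0 x)) in Tr. lra. }
    replace (mu * (2 * A) * exp (2 * T)) with
      (mu * (2 * tau k) * exp ((INR k + 2) * T)).
    + apply Rmult_le_compat_r; [left; apply exp_pos|].
      apply Rmult_le_compat_l; lra.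
    + unfold tau. replace ((INR k + 2) * T) with (INR k * T + 2 * T) by ring.
      rewrite exp_plus, exp_Ropp. field. apply Rgt_not_eq, exp_pos.
Qed.

(** The base point is moved at the smaller radius, where both points lie beyond [k * T]. There base
    distances are at most of order [exp (- (k * T))] times cone distances, while the Lebesgue
    numbers are of order [A * exp (- ((k + 1) * T))]. *)
Lemma cone_map_horizontal x x' L :
  cone_t x <= cone_t x' -> NoDup L ->
  sum_over L (fun v =>
    Rabs (f x v - cone_map d (inhabits z0) n E sigma T (cone_base z0 x') (cone_t x) v))
  <= 3 * INR n * (2 * INR n + 1) *
     ((INR n + 1) * (12 * exp T * exp (cone_dist d x x' / 2) * cone_dist d x x'
        / (mu * c * A))).
Proof.
  intros Hx HL.
  assert (Hr := proj1 (Hcosh x x')). set (rho := cone_dist d x x') in *.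
  assert (Hh := height_bounds T ltac:(lra) _ (cone_t_nonneg x)).
  assert (N : 1 <= INR n) by (apply (le_INR 1); lia).
  assert (Hp : 0 < mu * c * A) by (repeat apply Rmult_lt_0_compat; auto).
  assert (HD0 : 0 <= 12 * exp T * exp (rho / 2) * rho / (mu * c * A)).
  { apply Rdiv_le_0_compat; auto. apply Rmult_le_pos; [|auto].
    assert (P := exp_pos T). assert (P' := exp_pos (rho / 2)). nra. }
  apply (cell_horizontal d Hd (inhabits z0) n E sigma tau HE lebesgue_pos); auto;
    [|apply Rmult_le_pos; lra].
  set (k := level T (cone_t x)).
  intros k' Hk' i Hi. destruct (Nat.eq_dec k 0) as [e|e].
  (* On level 0 the radius may be too small for the horizontal estimate, but the coverings of levels
     0 and 1 are trivial and nothing changes. *)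
  - assert (Ht := Htriv k' ltac:(lia)).
    unfold wt. rewrite (weight_trivial d Hd _ n _ (lebesgue_pos k') i
      (cone_base z0 x) (cone_base z0 x') Ht).
    rewrite Rminus_diag, Rabs_R0. split.
    + apply Rmult_le_pos; lra.
    + intros Hne. exfalso. apply Hne. apply functional_extensionality. intros a.
      apply propositional_extensionality. now rewrite !Ht.
  - set (z := cone_base z0 x) in *. set (z' := cone_base z0 x') in *.
    assert (Hk : 1 <= INR k) by (apply (le_INR 1); lia).
    assert (Ls := proj1 (level_spec T ltac:(lra) _ (cone_t_nonneg x))). fold k in Ls.
    assert (H := cone_dist_ge_horizontal d z0 mu Hpi Hcosh x x' (INR k * T)
      ltac:(nra) Ls ltac:(lra)).
    fold rho z z' in H.
    assert (Pk := lebesgue_pos k').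
    assert (Hsk : sigma (S k) <= sigma k').
    { unfold sigma. apply Rmult_le_compat_l; [lra|].
      destruct Hk' as [->| ->]; [apply scale_S_le|lra]. }
    assert (P := proj1 Hd z z').
    assert (Hq : d z z' / sigma k' <= 12 * exp T * exp (rho / 2) * rho / (mu * c * A)).
    { apply Rle_trans with (d z z' / sigma (S k)).
      - apply Rmult_le_compat_l; auto. apply Rinv_le_contravar; auto. apply lebesgue_pos.
      - replace (d z z' / sigma (S k)) with
          (mu * d z z' * exp (INR k * T) * exp T / (mu * c * A)).
        + apply Rmult_le_compat_r; [left; now apply Rinv_0_lt_compat|].
          assert (PT := exp_pos T). nra.
        + unfold sigma, tau. rewrite S_INR, exp_Ropp.
          replace ((INR k + 1) * T) with (INR k * T + T) by ring. rewrite exp_plus.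
          assert (PT := exp_pos T). assert (PT' := exp_pos (INR k * T)).
          field. repeat split; lra. }
    assert (H0 : 0 <= d z z' / sigma k') by (apply Rdiv_le_0_compat; auto).
    split.
    + eapply Rle_trans; [apply (weight_lipschitz d Hd _ _ _ _ (HE k') Pk); auto|].
      apply Rmult_le_compat_l; lra.
    + intros Hne.
      assert (W := weight_neq_class d Hd _ _ _ _ (HE k') Pk i z z' Hne).
      assert (W' := weight_neq_class d Hd _ _ _ _ (HE k') Pk i z' z (not_eq_sym Hne)).
      destruct Hd as (_ & _ & Sy & _). rewrite (Sy z' z) in W'. unfold wt.
      apply Rle_trans with (2 * (d z z' / sigma k')); [lra|].
      apply Rmult_le_compat; lra.
Qed.

Context (lam : R) (Hlam : 0 < lam).
Context (HTlam : 18 * INR n / T <= lam / 2).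
Context (HAlam : 3 * INR n * (2 * INR n + 1) *
  ((INR n + 1) * (12 * exp T * exp (/ lam) / (mu * c * A))) <= lam / 2).

Lemma cone_map_lipschitz_ordered x x' L :
  cone_t x <= cone_t x' -> NoDup L ->
  sum_over L (fun v => Rabs (f x v - f x' v)) <= lam * cone_dist d x x'.
Proof.
  intros Hx HL.
  assert (Hr := proj1 (Hcosh x x')).
  assert (Hp : 0 < mu * c * A) by (repeat apply Rmult_lt_0_compat; auto).
  assert (N : 1 <= INR n) by (apply (le_INR 1); lia).
  (* For close points the factor [exp (rho / 2)] is at most [exp (/ lam)], and the horizontal and
     radial moves cost [lam / 2] each; for the others [lam * rho] exceeds the trivial bound 2. *)
  destruct (Rle_lt_dec (cone_dist d x x') (2 / lam)) as [Hs|Hs].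
  - eapply Rle_trans; [apply (sum_over_l1_triangle _ _
      (cone_map d (inhabits z0) n E sigma T (cone_base z0 x') (cone_t x)))|].
    assert (K1 := cone_map_horizontal x x' L Hx HL).
    assert (K2 := cone_map_radial d Hd (inhabits z0) n E sigma tau HE lebesgue_pos
      T ltac:(lra) Hn (cone_base z0 x') (cone_t x) (cone_t x') L (cone_t_nonneg x) Hx HL).
    fold (f x') in K2.
    assert (K3 := cone_dist_ge_radial d z0 mu Hcosh x x').
    rewrite Rabs_minus_sym, Rabs_pos_eq in K3 by lra.
    set (rho := cone_dist d x x') in *.
    assert (K4 : 18 * INR n / T * (cone_t x' - cone_t x) <= lam / 2 * rho)
      by (apply Rmult_le_compat; try lra; apply Rdiv_le_0_compat; lra).
    assert (K5 : exp (rho / 2) <= exp (/ lam)).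
    { apply exp_le_compat. replace (/ lam) with (2 / lam / 2) by (field; lra). lra. }
    assert (K6 : 3 * INR n * (2 * INR n + 1) *
      ((INR n + 1) * (12 * exp T * exp (rho / 2) * rho / (mu * c * A))) <= lam / 2 * rho).
    { eapply Rle_trans; [|apply Rmult_le_compat_r; [exact Hr|exact HAlam]].
      rewrite !(Rmult_assoc (3 * INR n * (2 * INR n + 1))).
      apply Rmult_le_compat_l; [nra|]. rewrite (Rmult_assoc (INR n + 1)).
      apply Rmult_le_compat_l; [lra|]. unfold Rdiv.
      replace (12 * exp T * exp (/ lam) * / (mu * c * A) * rho) with
        (12 * exp T * exp (/ lam) * rho * / (mu * c * A)) by ring.
      apply Rmult_le_compat_r; [left; now apply Rinv_0_lt_compat|].
      apply Rmult_le_compat_r; auto. apply Rmult_le_compat_l; auto.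
      assert (P := exp_pos T). lra. }
    lra.
  - apply Rle_trans with 2.
    + apply (cell_l1_le_2 d Hd (inhabits z0) n E sigma tau HE lebesgue_pos); auto;
        apply height_bounds; try lra; apply cone_t_nonneg.
    + replace 2 with (lam * (2 / lam)) by (field; lra).
      apply Rmult_le_compat_l; lra.
Qed.

Lemma cone_dist_sym x x' : cone_dist d x x' = cone_dist d x' x.
Proof.
  destruct (Hcosh x x') as [H1 H2], (Hcosh x' x) as [H3 H4].
  assert (He : cosh (cone_dist d x x') = cosh (cone_dist d x' x)).
  { rewrite H2, H4, (proj1 (proj2 (proj2 Hd)) (cone_base z0 x)).
    rewrite <- cosh_opp, Ropp_minus_distr. ring. }
  apply Rle_antisym.
  - rewrite <- (Rabs_pos_eq _ H1). apply cosh_le_inv; lra.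
  - rewrite <- (Rabs_pos_eq _ H3). apply cosh_le_inv; lra.
Qed.

Lemma cone_map_lipschitz x x' : l2_le (f x) (f x') (lam * cone_dist d x x').
Proof.
  intros L HL _. eapply Rle_trans; [apply sum_over_sq_le|].
  destruct (Rle_or_lt (cone_t x) (cone_t x')) as [h|h].
  - now apply cone_map_lipschitz_ordered.
  - rewrite cone_dist_sym.
    rewrite (sum_over_ext _ _ (fun v => Rabs (f x' v - f x v)))
      by (intros; apply Rabs_minus_sym).
    apply cone_map_lipschitz_ordered; [lra|auto].
Qed.

Lemma cone_map_polyhedron :
  exists (J : Type) (K : list J -> Prop) (g : Cone Z -> J -> R),
    subcomplex K /\ dim_le K n /\
    (forall a, in_polyhedron K (g a)) /\
    (forall a b, l2_le (g a) (g b) (lam * cone_dist d a b)) /\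
    (exists D : R, forall S, K S -> forall a b,
        in_simplex S (g a) -> in_simplex S (g b) -> cone_dist d a b <= D).
Proof.
  exists vertex,
    (* The simplices are the nonempty parts of supports of image points, so closure under faces is
       immediate and [cone_map_card] bounds the dimension. *)
    (fun S => NoDup S /\ S <> nil /\ exists x, forall v, In v S -> f x v <> 0), f.
  split; [split|split; [|split; [|split]]].
  - tauto.
  - intros S S' (_ & _ & x & Hx) H1 H2 H3. repeat split; auto.
    exists x. auto.
  - intros S (HS & _ & x & Hx). now apply (cone_map_card x).
  - intros a. destruct (cone_map_in_polyhedron_data a) as (S & H1 & H2 & H3 & H4).
    exists S. repeat split; auto; try apply H4. exists a. apply H3.
  - apply cone_map_lipschitz.
  - destruct cone_map_bounded_fibres as [D HD]. exists D.
    intros S (_ & _ & x & Hx) a b Ha Hb.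
    (* The support of [f a] is nonempty and contained in [S], hence in the support of [f x]. *)
    assert (Hv : forall a, in_simplex S (f a) -> exists v, f x v <> 0 /\ f a v <> 0).
    { intros y (_ & Hy & _).
      destruct (cone_map_in_polyhedron_data y) as ([|v S'] & _ & H2 & H3 & _);
        [congruence|].
      assert (Hn0 : f y v <> 0) by (apply H3; now left).
      exists v. auto. }
    destruct (Hv a Ha) as (u & Hu1 & Hu2), (Hv b Hb) as (v & Hv1 & Hv2).
    now apply (HD x a b u v).
Qed.
End Map.

Theorem theorem5p1 (Z : Type) (d : Z -> Z -> R)
  (Hd : is_metric d) (Hb : bounded_metric d) :
  forall m : nat, cdim_le d m -> asdim_le (cone_dist d) (m + 1)%nat.
Proof.
  intros m Hm lam Hlam.
  destruct (cdim_small_scales d Hd m Hm) as ([z0] & c0 & tau0 & Hc0 & Ht0 & Hsmall).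
  destruct (cone_angle_scale d Hd z0 Hb) as (mu & Hmu & Hpi & Hangle).
  assert (Hcosh := cone_dist_cosh d z0 mu Hangle).
  destruct Hb as [B HB].
  destruct (colour_cover_all_scales d (m + 1) (Rmax B 1) c0 tau0) as (c & Hc & Hall);
    auto; try lia.
  { assert (K := Rmax_r B 1). lra. }
  { intros x y. eapply Rle_trans; [apply HB|apply Rmax_l]. }
  set (n := (m + 1)%nat) in *. assert (Hn : (0 < n)%nat) by (unfold n; lia).
  assert (N : 1 <= INR n) by (apply (le_INR 1); lia).
  (* The summands give in turn [T >= 1], [c * exp T > 1] and the radial constant
     [18 * INR n / T <= lam / 2]. *)
  set (T := 1 + / c + 36 * INR n / lam).
  assert (Hic : 0 < / c) by now apply Rinv_0_lt_compat.
  assert (Hnl : 0 < 36 * INR n / lam) by (apply Rdiv_lt_0_compat; lra).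
  assert (HT : 1 <= T) by (unfold T; lra).
  assert (HcT : 1 < c * exp T).
  { replace 1 with (c * / c) by (field; lra). apply Rmult_lt_compat_l; [auto|].
    assert (K := exp_ineq1_le T). unfold T in *. lra. }
  assert (HTlam : 18 * INR n / T <= lam / 2).
  { apply Rmult_le_reg_r with T; [lra|].
    replace (18 * INR n / T * T) with (lam / 2 * (36 * INR n / lam)) by (field; lra).
    apply Rmult_le_compat_l; [lra|]. unfold T. lra. }
  set (C := 3 * INR n * (2 * INR n + 1) * ((INR n + 1) * (12 * exp T * exp (/ lam)))).
  assert (HC : 0 < C).
  { assert (P1 := exp_pos T). assert (P2 := exp_pos (/ lam)). unfold C.
    repeat apply Rmult_lt_0_compat; lra. }
  assert (Hmc : 0 < mu * c) by now apply Rmult_lt_0_compat.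
  assert (HB1 : 1 <= Rmax B 1) by apply Rmax_r.
  (* The first summand brings the scales of levels 0 and 1 above the diameter bound, so that their
     coverings are trivial; the second makes the horizontal constant at most [lam / 2]. *)
  set (A := Rmax B 1 * exp T + 2 * C / (mu * c * lam)).
  assert (HA2 : 0 < 2 * C / (mu * c * lam)).
  { apply Rdiv_lt_0_compat; [lra|]. now apply Rmult_lt_0_compat. }
  assert (HA1 : 0 < Rmax B 1 * exp T) by (apply Rmult_lt_0_compat; [lra|apply exp_pos]).
  assert (HA : 0 < A) by (unfold A; lra).
  assert (HAlam : 3 * INR n * (2 * INR n + 1) *
    ((INR n + 1) * (12 * exp T * exp (/ lam) / (mu * c * A))) <= lam / 2).
  { replace (3 * INR n * (2 * INR n + 1) *
      ((INR n + 1) * (12 * exp T * exp (/ lam) / (mu * c * A))))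
      with (C / (mu * c * A)) by (unfold C; field; lra).
    assert (Hp : 0 < mu * c * A) by now apply Rmult_lt_0_compat.
    apply Rmult_le_reg_r with (mu * c * A); [auto|].
    replace (C / (mu * c * A) * (mu * c * A)) with
      (lam / 2 * (mu * c) * (2 * C / (mu * c * lam))) by (field; lra).
    rewrite <- !Rmult_assoc. rewrite (Rmult_assoc (lam / 2) mu c).
    apply Rmult_le_compat_l; [|unfold A; lra].
    apply Rmult_le_pos; lra. }
  destruct (choice (fun k E => colour_cover d E n (c * (A * exp (- (INR k * T))))
     (A * exp (- (INR k * T))) /\ (Rmax B 1 <= A * exp (- (INR k * T)) ->
     forall i z a, E i z a <-> i = 0%nat))) as [E HE].
  { intros k. apply Hall. apply Rmult_lt_0_compat; [auto|apply exp_pos]. }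
  apply (cone_map_polyhedron d Hd z0 mu Hmu Hpi Hcosh n Hn c A T Hc HA HT HcT E);
    auto.
  - intros k. apply HE.
  - intros k Hk. apply HE.
    assert (Hk1 : INR k <= 1) by (apply (le_INR k 1); lia).
    apply Rle_trans with (Rmax B 1 * exp T * exp (- (INR k * T))).
    + rewrite Rmult_assoc, <- exp_plus.
      rewrite <- (Rmult_1_r (Rmax B 1)) at 1. apply Rmult_le_compat_l; [lra|].
      rewrite <- exp_0. apply exp_le_compat. nra.
    + apply Rmult_le_compat_r; [left; apply exp_pos|]. unfold A. lra.
Qed.
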